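(* Let $p\ge 1$ be an integer and let $f\in C^{p+6}$, $f:\mathbb{R}\times\mathbb{R}\to\mathbb{R}$, $(x,\alpha)\mapsto f(x,\alpha)$, satisfy the transcritical conditions $f(0,\alpha)=0$ for all sufficiently small $|\alpha|$, $f_x(0,0)=0$, $f_{xx}(0,0)\neq 0$, $f_{x\alpha}(0,0)\neq 0$. Let $\Phi(h,\cdot,\alpha)$ be the time-$h$ map of the flow of $\dot x=f(x,\alpha)$, and let $\varphi(h,x,\alpha)$ be a sufficiently smooth one-step discretization map of order $p$ with step-size $h$, i.e. $|\Phi(h,x,\alpha)-\varphi(h,x,\alpha)|\le C h^{p+1}$ for all sufficiently small $h\ge 0$, $|x|$, $|\alpha|$ with some constant $C$, such that $\varphi(h,0,\alpha)=0$ for all sufficiently small $h\ge 0$ and $|\alpha|$. Let $\mathcal{N}_\Phi$ and $\mathcal{N}_\varphi$ be the normal forms of $\Phi$ and $\varphi$ and let $J$ be the conjugacy between them constructed as described in the context. Then there is a constant $const>0$, independent of $h$, $x$ and $\alpha$, such that for all $0<h\le h_0$, $|x|\le \varepsilon_0$ and $|\alpha|\le\alpha_0$ $$|x-J(h,x,\alpha)|\le const\cdot h^p .$$ This estimate is optimal in $h$, in the sense that in general the exponent $p$ cannot be improved: there exist maps $\mathcal{N}_\Phi,\mathcal{N}_\varphi$ of the normal form type described in the context (satisfying $|\mathcal{N}_\Phi-\mathcal{N}_\varphi|\le c\,h^{p+1}|x|^3$) such that for every sufficiently small $\alpha>0$ there is a constant $const(\alpha)>0$ with $\sup_{|x|\le\varepsilon_0}|x-J(h,x,\alpha)|\ge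 const(\alpha)\cdot h^p$ for all sufficiently small $h>0$.
   Context: **Normal forms.** Under the hypotheses on $f$ and $\varphi$, there are smooth invertible coordinate and parameter changes (those for $\Phi$ and those for $\varphi$ being $\mathcal{O}(h^p)$-close to each other) transforming $x\mapsto\Phi(h,x,\alpha)$ and $x\mapsto\varphi(h,x,\alpha)$, after a final parameter shift that is $\mathcal{O}(h^p)$-close to the identity and aligns the bifurcation parameters, into $$\mathcal{N}_\Phi(h,x,\alpha)=(1+h\alpha)x+s\,hx^2+hx^3\eta_3(h,x,\alpha),\qquad \mathcal{N}_\varphi(h,x,\alpha)=(1+h\alpha)x+s\,hx^2+hx^3\widetilde\eta_3(h,x,\alpha),$$ with $s\in\{1,-1\}$ the same for both and $\eta_3,\widetilde\eta_3$ smooth ($C^k$ with $k$ large enough and bounded derivatives). The new coordinate and the new parameter are again denoted by $x$ and $\alpha$. The sign $s$ only affects the orientation of the bifurcation diagram, and $s=1$ is chosen. There is $c>0$ with $$|\mathcal{N}_\Phi(h,x,\alpha)-\mathcal{N}_\varphi(h,x,\alpha)|\le c\,h^{p+1}|x|^3$$ for all small $h>0$, $|x|$, $|\alpha|$. Let $K>0$ be a uniform bound for $|\partial_x^i\eta|$ ($i=0,1,2$) and $|\partial_\alpha\eta|$, $\eta\in\{\eta_3,\widetilde\eta_3\}$. Put $h_0=\frac15$, $\varepsilon_0=\min(\frac1{25},\frac1{25K})$, $\alpha_0=\min(\frac1{51},\frac1{51K})$, suitably decreased further (keeping $2\alpha_0<\varepsilon_0$) if $\eta_3,\widetilde\eta_3$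 are only defined, or the estimate $|\mathcal{N}_\Phi(h,x,\alpha)-\mathcal{N}_\varphi(h,x,\alpha)|\le c\,h^{p+1}|x|^3$ only holds, on a smaller set. **Notation.** For fixed $h\in(0,h_0]$, $\alpha\in[-\alpha_0,\alpha_0]$ write $N_\Phi=\mathcal{N}_\Phi(h,\cdot,\alpha)$, $N_\varphi=\mathcal{N}_\varphi(h,\cdot,\alpha)$, $J=J(h,\cdot,\alpha)$; $g^{[k]}$ is the $k$-th iterate of $g$ ($g^{[-1]}$ the inverse). $N_\Phi,N_\varphi$ are strictly increasing and fix $0$. For $\alpha>0$ each has exactly one negative fixed point near $0$, denoted $\omega_{\Phi,-}$, $\omega_{\varphi,-}$ (attracting); for $\alpha<0$ each has exactly one positive fixed point near $0$, denoted $\omega_{\Phi,+}$, $\omega_{\varphi,+}$ (repelling). **Construction of $J$ for $x\le 0$** (it satisfies $J\circ N_\varphi=N_\Phi\circ J$). *Inner region*, $0<\alpha\le\alpha_0$, $x\in[\omega_{\varphi,-},0]$: let $x_0=-\frac{\alpha}{3}$, $x_{n+1}=N_\varphi(x_n)$, $y_n=N_\varphi^{[-n]}(x_0)$ ($n\ge0$), $y_{-1}=x_1$. Then $x_n\downarrow\omega_{\varphi,-}$ and $y_n\uparrow0$. Set $J(x_0)=x_0$, $J(x_1)=N_\Phi(x_0)$, $J$ linear on $[x_1,x_0]$; recursively $J=N_\Phi\circ J\circ N_\varphi^{[-1]}$ on $[x_{n+1},x_n]$ ($n\ge1$) and $J=N_\Phi^{[-1]}\circ J\circ N_\varphi$ on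 $[y_n,y_{n+1}]$ ($n\ge0$); $J(\omega_{\varphi,-})=\omega_{\Phi,-}$, $J(0)=0$. *Outer region*: let $z_0=-\varepsilon_0$, $z_n=N_\varphi^{[n]}(z_0)$; then $z_n$ increases to $\omega_{\varphi,-}$ if $\alpha>0$ and to $0$ if $\alpha\le0$. Set $J(z_0)=z_0$, $J(z_1)=N_\Phi(z_0)$, $J$ linear on $[z_0,z_1]$, and recursively $J=N_\Phi\circ J\circ N_\varphi^{[-1]}$ on $[z_n,z_{n+1}]$ ($n\ge1$); for $\alpha\le 0$ also $J(0)=0$. **Construction of $J$ for $x>0$** is analogous, with the roles of the maps and their inverses exchanged: for $-\alpha_0\le\alpha<0$ and $x\in[0,\omega_{\varphi,+}]$ one starts at $x_0=-\frac\alpha3>0$, uses $x_n=N_\varphi^{[-n]}(x_0)\uparrow\omega_{\varphi,+}$ and $y_n=N_\varphi^{[n]}(x_0)\downarrow0$, $J(x_0)=x_0$, $J(x_1)=N_\Phi^{[-1]}(x_0)$, linear on $[x_0,x_1]$, extended by $J=N_\Phi^{[-1]}\circ J\circ N_\varphi$ and $J=N_\Phi\circ J\circ N_\varphi^{[-1]}$, respectively, and $J(\omega_{\varphi,+})=\omega_{\Phi,+}$; in the outer region one uses $z_0=\varepsilon_0$, $z_n=N_\varphi^{[-n]}(z_0)$, $J(z_0)=z_0$, $J(z_1)=N_\Phi^{[-1]}(z_0)$, linear on $[z_1,z_0]$, extended by $J=N_\Phi^{[-1]}\circ J\circ N_\varphi$. *)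

(* Defs.v *)
From Stdlib Require Import Reals ClassicalEpsilon.
From Coquelicot Require Import Coquelicot.
Open Scope R_scope.

(** * Classes C^k

    All functions have the three arguments [h], [x], [alpha] (in this order); a
    function of fewer variables is one that ignores some of its arguments. *)

(** [U] is meant to be open, so that the two-sided [Derive] is the partial
    derivative at each of its points. *)
Fixpoint Ck (k : nat) (U : R * R * R -> Prop) (g : R -> R -> R -> R) : Prop :=
  (forall q, U q -> continuous (fun q : R * R * R => g (fst (fst q)) (snd (fst q)) (snd q)) q) /\
  match k with
  | O => True
  | S k' =>
      (forall h x a, U (h, x, a) ->
         ex_derive (fun t => g t x a) h /\
         ex_derive (fun t => g h t a) x /\
         ex_derive (fun t => g h x t) a) /\
      Ck k' U (fun h x a => Derive (fun t => g t x a) h) /\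
      Ck k' U (fun h x a => Derive (fun t => g h t a) x) /\
      Ck k' U (fun h x a => Derive (fun t => g h x t) a)
  end.

Definition Ck_near (k : nat) (D : R * R * R -> Prop) (g : R -> R -> R -> R) : Prop :=
  exists U : R * R * R -> Prop, open U /\ (forall q, D q -> U q) /\ Ck k U g.

(** C^k on a set that need not be open: restriction of a C^k function defined
    near that set.  This is how one-sided smoothness at [h = 0] is expressed. *)
Definition Ck_on (k : nat) (D : R * R * R -> Prop) (g : R -> R -> R -> R) : Prop :=
  exists g' : R -> R -> R -> R,
    Ck_near k D g' /\ forall h x a, D (h, x, a) -> g' h x a = g h x a.

Definition box (h0 e0 a0 : R) (q : R * R * R) : Prop :=
  0 <= fst (fst q) <= h0 /\ Rabs (snd (fst q)) <= e0 /\ Rabs (snd q) <= a0.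

(** * The differential equation and its discretization *)

Definition transcritical (d : R) (f : R -> R -> R) : Prop :=
  (forall a, Rabs a <= d -> f 0 a = 0) /\
  Derive (fun x => f x 0) 0 = 0 /\
  Derive_n (fun x => f x 0) 2 0 <> 0 /\
  Derive (fun a => Derive (fun x => f x a) 0) 0 <> 0.

Definition time_map (d : R) (f : R -> R -> R) (Phi : R -> R -> R -> R) : Prop :=
  forall h x a, box d d d (h, x, a) ->
    exists u : R -> R,
      u 0 = x /\
      (forall t, 0 <= t <= h -> is_derive u t (f (u t) a)) /\
      Phi h x a = u h.

Definition discretization (d : R) (p : nat) (Phi phi : R -> R -> R -> R) : Prop :=
  Ck_on (p + 6) (box d d d) phi /\
  (exists C, forall h x a, box d d d (h, x, a) ->
     Rabs (Phi h x a - phi h x a) <= C * h ^ (p + 1)) /\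
  (forall h a, box d d d (h, 0, a) -> phi h 0 a = 0).

(** * Normal forms *)

Record normal_form (k : nat) (h0 e0 a0 K : R) (N eta : R -> R -> R -> R) : Prop := {
  nf_smooth : Ck_near k (box h0 e0 a0) eta;
  nf_bound : forall h x a, box h0 e0 a0 (h, x, a) ->
    Rabs (eta h x a) <= K /\
    Rabs (Derive (fun t => eta h t a) x) <= K /\
    Rabs (Derive_n (fun t => eta h t a) 2 x) <= K /\
    Rabs (Derive (fun t => eta h x t) a) <= K;
  nf_eq : forall h x a, box h0 e0 a0 (h, x, a) ->
    N h x a = (1 + h * a) * x + h * x ^ 2 + h * x ^ 3 * eta h x a }.

Definition eps_of (K : R) : R := Rmin (1 / 25) (1 / (25 * K)).
Definition alp_of (K : R) : R := Rmin (1 / 51) (1 / (51 * K)).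

Definition admissible_box (K h0 e0 a0 : R) : Prop :=
  0 < h0 <= 1 / 5 /\ 0 < e0 <= eps_of K /\ 0 < a0 <= alp_of K /\ 2 * a0 < e0.

Record normal_form_pair (p k : nat) (h0 e0 a0 K c : R)
    (NPhi Nphi eta eta' : R -> R -> R -> R) : Prop := {
  nfp_K : 0 < K;
  nfp_c : 0 < c;
  nfp_box : admissible_box K h0 e0 a0;
  nfp_Phi : normal_form k h0 e0 a0 K NPhi eta;
  nfp_phi : normal_form k h0 e0 a0 K Nphi eta';
  nfp_close : forall h x a, 0 < h <= h0 -> Rabs x <= e0 -> Rabs a <= a0 ->
    Rabs (NPhi h x a - Nphi h x a) <= c * h ^ (p + 1) * Rabs x ^ 3 }.

(** The maps [X h . a] are invertible on [D], with C^k inverses. *)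
Definition smooth_invertible (k : nat) (D : R * R * R -> Prop)
    (X : R -> R -> R -> R) : Prop :=
  Ck_on k D X /\
  exists Y : R -> R -> R -> R,
    Ck_on k (fun q => exists xi, D (fst (fst q), xi, snd q) /\
                                 snd (fst q) = X (fst (fst q)) xi (snd q)) Y /\
    forall h xi a, D (h, xi, a) -> Y h (X h xi a) a = xi.

(** [X h . b] and [P h .] express the old coordinate and the old parameter
    through the new ones, where [b] is the new parameter; the domain has radius
    [r] in the new coordinate and [rho] in the new parameter, and the image lies
    in the domain of radius [d] of the original maps. *)
Record coordinate_change (k : nat) (d h0 r rho : R)
    (X : R -> R -> R -> R) (P : R -> R -> R) : Prop := {
  cc_coord : smooth_invertible k (box h0 r rho) X;
  cc_param : smooth_invertible k (box h0 rho 0) (fun h b _ => P h b);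
  cc_origin : X 0 0 0 = 0 /\ P 0 0 = 0;
  cc_range : forall h x b, box h0 r rho (h, x, b) ->
    Rabs (X h x b) <= d /\ Rabs (P h b) <= d }.

(** [S h .] is the final parameter shift, applied to the parameter of the
    discretization. *)
Definition normal_forms_of (p k : nat) (d h0 e0 a0 : R)
    (Phi phi NPhi Nphi : R -> R -> R -> R) : Prop :=
  h0 <= d /\
  exists (r rho C : R) (XPhi Xphi : R -> R -> R -> R) (PPhi Pphi S : R -> R -> R),
    e0 <= r /\ a0 <= rho /\
    coordinate_change k d h0 r rho XPhi PPhi /\
    coordinate_change k d h0 r rho Xphi Pphi /\
    smooth_invertible k (box h0 a0 0) (fun h a _ => S h a) /\
    (forall h x b, box h0 r rho (h, x, b) ->
       Rabs (XPhi h x b - Xphi h x b) <= C * h ^ p /\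
       Rabs (PPhi h b - Pphi h b) <= C * h ^ p) /\
    (forall h a, 0 <= h <= h0 -> Rabs a <= a0 ->
       Rabs (S h a - a) <= C * h ^ p /\ Rabs (S h a) <= rho) /\
    (forall h x a, box h0 e0 a0 (h, x, a) ->
       Rabs (NPhi h x a) <= r /\
       Phi h (XPhi h x a) (PPhi h a) = XPhi h (NPhi h x a) a) /\
    (forall h x a, box h0 e0 a0 (h, x, a) ->
       Rabs (Nphi h x a) <= r /\
       phi h (Xphi h x (S h a)) (Pphi h (S h a)) = Xphi h (Nphi h x a) (S h a)).

(** * The conjugacy *)

(** Inverse of [g] restricted to [[-e, e]]. *)
Definition inv_on (e : R) (g : R -> R) (y : R) : R :=
  epsilon (inhabits 0) (fun x => -e <= x <= e /\ g x = y).

(** The affine function with [u |-> u'] and [v |-> v']. *)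
Definition affine (u u' v v' x : R) : R := u' + (v' - u') / (v - u) * (x - u).

(** Graph of the conjugacy for fixed [h] and [alpha], where [g] is the normal
    form of the discretization and [G] that of the time-[h] map.  In the names,
    [neg]/[pos] is the sign of [x]; [in]/[out] is the region, i.e. between the
    origin and the nontrivial fixed point, or beyond it. *)
Inductive conj_graph (g G : R -> R) (e alpha : R) | : R -> R -> Prop :=
| cg_zero : conj_graph 0 0
| cg_neg_fix : forall w W, 0 < alpha ->
    -e <= w < 0 -> g w = w -> -e <= W < 0 -> G W = W ->
    conj_graph w W
| cg_neg_in_base : forall x, 0 < alpha ->
    let x0 := - alpha / 3 in
    g x0 <= x <= x0 ->
    conj_graph x (affine (g x0) (G x0) x0 x0 x)
| cg_neg_in_down : forall n x y, 0 < alpha -> (1 <= n)%nat ->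
    let x0 := - alpha / 3 in
    Nat.iter (S n) g x0 <= x <= Nat.iter n g x0 ->
    conj_graph (inv_on e g x) y ->
    conj_graph x (G y)
| cg_neg_in_up : forall n x y, 0 < alpha ->
    let x0 := - alpha / 3 in
    Nat.iter n (inv_on e g) x0 <= x <= Nat.iter (S n) (inv_on e g) x0 ->
    conj_graph (g x) y ->
    conj_graph x (inv_on e G y)
| cg_neg_out_base : forall x,
    let z0 := - e in
    z0 <= x <= g z0 ->
    conj_graph x (affine z0 z0 (g z0) (G z0) x)
| cg_neg_out_up : forall n x y, (1 <= n)%nat ->
    let z0 := - e in
    Nat.iter n g z0 <= x <= Nat.iter (S n) g z0 ->
    conj_graph (inv_on e g x) y ->
    conj_graph x (G y)
| cg_pos_fix : forall w W, alpha < 0 ->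
    0 < w <= e -> g w = w -> 0 < W <= e -> G W = W ->
    conj_graph w W
| cg_pos_in_base : forall x, alpha < 0 ->
    let x0 := - alpha / 3 in
    x0 <= x <= inv_on e g x0 ->
    conj_graph x (affine x0 x0 (inv_on e g x0) (inv_on e G x0) x)
| cg_pos_in_up : forall n x y, alpha < 0 -> (1 <= n)%nat ->
    let x0 := - alpha / 3 in
    Nat.iter n (inv_on e g) x0 <= x <= Nat.iter (S n) (inv_on e g) x0 ->
    conj_graph (g x) y ->
    conj_graph x (inv_on e G y)
| cg_pos_in_down : forall n x y, alpha < 0 ->
    let x0 := - alpha / 3 in
    Nat.iter (S n) g x0 <= x <= Nat.iter n g x0 ->
    conj_graph (inv_on e g x) y ->
    conj_graph x (G y)
| cg_pos_out_base : forall x,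
    let z0 := e in
    inv_on e g z0 <= x <= z0 ->
    conj_graph x (affine (inv_on e g z0) (inv_on e G z0) z0 z0 x)
| cg_pos_out_down : forall n x y, (1 <= n)%nat ->
    let z0 := e in
    Nat.iter (S n) (inv_on e g) z0 <= x <= Nat.iter n (inv_on e g) z0 ->
    conj_graph (g x) y ->
    conj_graph x (inv_on e G y).

Definition conjJ (NPhi Nphi : R -> R -> R -> R) (e0 : R) (h x alpha : R) : R :=
  epsilon (inhabits 0)
    (conj_graph (fun t => Nphi h t alpha) (fun t => NPhi h t alpha) e0 alpha x).

(* Main.v *)
Require Import Defs.
From Stdlib Require Import Reals Lra Lia ClassicalEpsilon FunctionalExtensionality.
From Coquelicot Require Import Coquelicot.
Open Scope R_scope.

(** The conjugacy is defined by transport: it is affine on a fundamental interval of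
    each region, and elsewhere [J] is [G o J o g^-1] or [G^-1 o J o g], where [g] and
    [G] are the normal forms of the discretization and of the time map for fixed [h]
    and [alpha].  So a bound on the distance of [x] and [J x] is proved by finding a
    quantity that is small on the fundamental interval and that one step of the
    recursion does not increase beyond the bound.  One step adds an error of order
    [h * h^p * |x|^3]; what must be found is a contraction that pays for it, with a
    rate uniform enough in [h], [x] and [alpha].

    Over [x <= 0] there are three regions.  Beyond the nontrivial fixed point (or up
    to the origin if [alpha <= 0]) the maps contract [|x - y|] at rate [h |x|]
    ([step_outer]).  Between [- alpha / 3] and the origin the inverses, which the
    recursion uses there, contract [|x - y|] at rate [h alpha] ([step_inner_up]).
    Between the fixed point and [- alpha / 3] the quantity is [|1/x - 1/y|], because
    the vector field [alpha x + x^2] is affine in the coordinate [1 / x]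
    ([step_inner_down]).  In each case the error of one step is at most a constant
    times [h^p] times the rate, so a bound of the form [const * h^p] reproduces
    itself.  Induction over the construction gives [left_graph_close]; it also shows
    that the fixed points correspond, and these are close because the drift of a map
    away from its fixed point has a lower bound.  Conversely the construction reaches
    every [x] ([left_graph_total]), so the chosen value [J x] is one to which the
    bound applies.

    The part over [x > 0] needs no new estimate.  The inverse of a normal form,
    conjugated by [x |-> - x], is again a map of the same kind with the opposite
    parameter ([full_map_mirror]), and this exchanges the two halves of the
    construction ([conj_graph_split], [mirror_graph_conj]).

    For optimality take [eta = 0] and [eta' = h^p].  The nontrivial fixed points are
    [- alpha] and a solution [w] of [alpha + w + h^p w^2 = 0], they correspond under
    [J], and their distance is [h^p w^2]. *)

(** * Intermediate values and crossing of a level *)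

Lemma lipschitz_ivt : forall (f : R -> R) (a b L m : R), a <= b ->
  (forall x y, a <= x -> x <= y -> y <= b -> Rabs (f y - f x) <= L * (y - x)) ->
  f a <= m <= f b -> exists x, a <= x <= b /\ f x = m.
Proof.
  intros f a b L m Hab HL Hm.
  (* [f] is clamped to [[a, b]] to make it continuous on the whole line. *)
  pose (cl := fun x => Rmax a (Rmin x b)).
  assert (Hcl : forall x y, x <= y -> a <= cl x /\ cl x <= cl y /\ cl y <= b /\ cl y - cl x <= y - x).
  { intros x y Hxy. unfold cl.
    unfold Rmax, Rmin; repeat destruct Rle_dec; lra. }
  assert (Hc : continuity (fun x => f (cl x))).
  { intros x0 eps Heps.
    exists (eps / (Rabs L + 1)).
    assert (HL0 := Rabs_pos L). assert (HL1 := Rle_abs L).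
    split.
    - apply Rdiv_lt_0_compat; lra.
    - intros x [_ Hx]. simpl in *. unfold Rdist in *.
      apply Rle_lt_trans with ((Rabs L + 1) * Rabs (x - x0)).
      + destruct (Rle_dec x0 x) as [H|H].
        * destruct (Hcl x0 x H) as (H1 & H2 & H3 & H4).
          specialize (HL (cl x0) (cl x) H1 H2 H3).
          rewrite (Rabs_pos_eq (x - x0)) by lra. nra.
        * destruct (Hcl x x0) as (H1 & H2 & H3 & H4); [lra|].
          specialize (HL (cl x) (cl x0) H1 H2 H3).
          rewrite Rabs_minus_sym, (Rabs_left1 (x - x0)) by lra. nra.
      + apply Rlt_div_r in Hx; lra. }
  assert (Ea : cl a = a) by (unfold cl, Rmax, Rmin; repeat destruct Rle_dec; lra).
  assert (Eb : cl b = b) by (unfold cl, Rmax, Rmin; repeat destruct Rle_dec; lra).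
  destruct (IVT_gen (fun x => f (cl x)) a b m Hc) as [x [Hx Hfx]].
  - rewrite Ea, Eb. rewrite Rmin_left, Rmax_right; lra.
  - rewrite Rmin_left, Rmax_right in Hx by lra.
    exists (cl x). destruct (Hcl x x) as (H1 & _ & H3 & _); [lra|]. auto.
Qed.

(** A sequence that gains at least [d] whenever it stays below [x] must step
    over [x]: this replaces convergence of the orbits to the fixed points. *)
Lemma staircase : forall (u : nat -> R) (x d : R), 0 < d -> u O <= x ->
  (forall n, u n <= x -> u (S n) <= x -> u n + d <= u (S n)) ->
  exists n, u n <= x <= u (S n).
Proof.
  intros u x d Hd H0 Hs.
  apply NNPP. intros Hn.
  assert (H : forall n, u n <= x /\ u O + INR n * d <= u n).
  { induction n as [|n [H1 H2]].
    - simpl. lra.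
    - assert (H3 : u (S n) <= x).
      { destruct (Rle_dec (u (S n)) x); [assumption|].
        exfalso. apply Hn. exists n. lra. }
      specialize (Hs n H1 H3). rewrite S_INR. lra. }
  destruct (INR_unbounded ((x - u O) / d)) as [n Hn'].
  destruct (H n) as [H1 H2].
  apply (Rmult_lt_compat_r d) in Hn'; [|lra].
  unfold Rdiv in Hn'. rewrite Rmult_assoc, Rinv_l in Hn' by lra. lra.
Qed.

(** * Maps on the negative half-line *)

(** [a] is the bifurcation parameter, which enters the construction of the
    conjugacy only through the starting point [- a / 3]; [1 + h * b] is the
    multiplier at the origin.  They agree for a normal form but not for the
    reflected inverse of one, whose multiplier is [1 / (1 + h * a)]. *)
Record ranges (e h a b : R) : Prop := {
  rg_h : 0 < h <= 1 / 5;
  rg_e : 0 < e <= 1 / 25;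
  rg_a : 2 * Rabs a < e;
  rg_b : Rabs (b - a) <= Rabs a / 100 }.

(** Difference quotients of a map [x + h (b x + x^2 + O(x^3))] on [[- e, 0]].
    This form is kept, instead of a normal form with a smooth remainder, because it
    is all that the estimates use and because it survives inversion and
    reflection; the constant [11 / 50] leaves room for what the latter costs. *)
Record left_map (e h b : R) (g gi : R -> R) : Prop := {
  lm_zero : g 0 = 0;
  lm_diff : forall x y, -e <= x -> x <= y -> y <= 0 ->
    exists rho, Rabs rho <= 11 / 50 * - x /\
      g y - g x = (y - x) * (1 + h * (b + x + y + rho));
  lm_inv_l : forall x, -e <= x <= 0 -> gi (g x) = x;
  lm_inv_r : forall y, g (-e) <= y <= 0 -> -e <= gi y <= 0 /\ g (gi y) = y }.

Lemma ranges_bounds : forall e h a b, ranges e h a b ->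
  - (101 / 200) * e < b < 101 / 200 * e.
Proof.
  intros e h a b [Hh He Ha Hb].
  revert Ha Hb. unfold Rabs. repeat destruct Rcase_abs; lra.
Qed.

Lemma ranges_pos : forall e h a b, ranges e h a b -> 0 < a ->
  99 / 100 * a <= b <= 101 / 100 * a /\ 2 * a < e.
Proof.
  intros e h a b [Hh He Ha Hb] H.
  revert Ha Hb. unfold Rabs. repeat destruct Rcase_abs; lra.
Qed.

Lemma ranges_nonpos : forall e h a b, ranges e h a b -> a <= 0 -> b <= 0.
Proof.
  intros e h a b [Hh He Ha Hb] H.
  revert Ha Hb. unfold Rabs. repeat destruct Rcase_abs; lra.
Qed.

Lemma left_map_slope : forall e h a b g gi x y, ranges e h a b -> left_map e h b g gi ->
  -e <= x -> x <= y -> y <= 0 ->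
  9 / 10 * (y - x) <= g y - g x <= 11 / 10 * (y - x).
Proof.
  intros e h a b g gi x y R L Hx Hxy Hy.
  assert (Hb := ranges_bounds _ _ _ _ R). destruct R as [Hh He _ _].
  destruct (lm_diff _ _ _ _ _ L x y Hx Hxy Hy) as (rho & Hr & E).
  apply Rabs_le_between in Hr. rewrite E.
  set (q := b + x + y + rho). assert (Hq : -1/2 <= q <= 1/2) by (unfold q; lra).
  assert (H : -1/10 <= h * q <= 1/10) by nra.
  clearbody q. nra.
Qed.

Lemma left_map_increasing : forall e h a b g gi x y, ranges e h a b -> left_map e h b g gi ->
  -e <= x -> x < y -> y <= 0 -> g x < g y.
Proof.
  intros e h a b g gi x y R L Hx Hxy Hy.
  assert (H := left_map_slope _ _ _ _ _ _ x y R L Hx (Rlt_le _ _ Hxy) Hy). lra.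
Qed.

Lemma left_map_nondecreasing : forall e h a b g gi x y, ranges e h a b -> left_map e h b g gi ->
  -e <= x -> x <= y -> y <= 0 -> g x <= g y.
Proof.
  intros e h a b g gi x y R L Hx Hxy Hy.
  assert (H := left_map_slope _ _ _ _ _ _ x y R L Hx Hxy Hy). lra.
Qed.

Lemma left_map_at : forall e h b g gi x, left_map e h b g gi -> -e <= x <= 0 ->
  exists rho, Rabs rho <= 11 / 50 * - x /\ g x = x * (1 + h * (b + x + rho)).
Proof.
  intros e h b g gi x L Hx.
  destruct (lm_diff _ _ _ _ _ L x 0) as (rho & Hr & E); try lra.
  exists rho. split; [assumption|]. rewrite (lm_zero _ _ _ _ _ L) in E.
  replace (b + x + rho) with (b + x + 0 + rho) by ring. lra.
Qed.

Lemma left_map_edge : forall e h a b g gi, ranges e h a b -> left_map e h b g gi ->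
  -e < g (-e).
Proof.
  intros e h a b g gi R L.
  assert (Hb := ranges_bounds _ _ _ _ R). destruct R as [Hh He _ _].
  destruct (left_map_at _ _ _ _ _ (-e) L) as (rho & Hr & E); [lra|].
  apply Rabs_le_between in Hr. rewrite E.
  assert (0 < h * e) by nra.
  assert (0 < h * e * (e - b - rho)) by (apply Rmult_lt_0_compat; lra). nra.
Qed.

Lemma left_map_range : forall e h a b g gi x, ranges e h a b -> left_map e h b g gi ->
  -e <= x < 0 -> -e < g x < 0.
Proof.
  intros e h a b g gi x R L Hx.
  assert (H1 := left_map_edge _ _ _ _ _ _ R L).
  assert (H2 := left_map_nondecreasing _ _ _ _ _ _ (-e) x R L).
  assert (H3 := left_map_increasing _ _ _ _ _ _ x 0 R L).
  rewrite (lm_zero _ _ _ _ _ L) in H3. lra.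
Qed.

(** * Fixed points and the drift away from them *)

Definition left_fixpoint (e : R) (g : R -> R) (w : R) : Prop := -e <= w < 0 /\ g w = w.

Lemma left_fixpoint_exists : forall e h a b g gi, ranges e h a b -> left_map e h b g gi ->
  0 < a -> exists w, left_fixpoint e g w.
Proof.
  intros e h a b g gi R L Ha.
  assert (Hb := ranges_bounds _ _ _ _ R). assert (Hb' := ranges_pos _ _ _ _ R Ha).
  assert (He := left_map_edge _ _ _ _ _ _ R L).
  destruct (lipschitz_ivt (fun t => t - g t) (-e) (- b / 2) 1 0) as (w & Hw & E).
  - lra.
  - intros x y Hx Hxy Hy.
    assert (H := left_map_slope _ _ _ _ _ _ x y R L Hx Hxy ltac:(lra)).
    apply Rabs_le. lra.
  - split; [lra|].
    destruct (left_map_at _ _ _ _ _ (-b/2) L) as (rho & Hr & E); [lra|].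
    apply Rabs_le_between in Hr. rewrite E. destruct R as [Hh _ _ _].
    assert (0 < h * b) by nra.
    assert (0 < h * b * (b / 2 + rho)) by (apply Rmult_lt_0_compat; lra). nra.
  - exists w. split; lra.
Qed.

(** The fixed point solves [b + w + rho = 0]; the constants [39 / 50] and
    [61 / 50] used from here on are [1 - 11 / 50] and [1 + 11 / 50]. *)
Lemma left_fixpoint_bounds : forall e h a b g gi w, ranges e h a b -> left_map e h b g gi ->
  left_fixpoint e g w -> 39 / 50 * - w <= b <= 61 / 50 * - w.
Proof.
  intros e h a b g gi w R L [Hw E].
  destruct (left_map_at _ _ _ _ _ w L) as (rho & Hr & E'); [lra|].
  apply Rabs_le_between in Hr. destruct R as [Hh _ _ _].
  assert (H : (h * - w) * (b + w + rho) = 0) by lra.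
  apply Rmult_integral in H. destruct H as [H|H]; [nra|lra].
Qed.

(** The drift is compared with that of the vector field [x (x - w)].  An explicit
    lower bound, rather than a sign, serves three purposes: uniqueness of the fixed
    point, stability of the fixed point under perturbation of the map, and the
    arrival of orbits at any point before the fixed point in finitely many steps. *)
Lemma left_drift_outer : forall e h a b g gi w t, ranges e h a b -> left_map e h b g gi ->
  left_fixpoint e g w -> -e <= t <= w ->
  h * - t * (w - t) / 10 <= g t - t.
Proof.
  intros e h a b g gi w t R L Fw Ht.
  assert (Hb := left_fixpoint_bounds _ _ _ _ _ _ _ R L Fw). destruct Fw as [Hw E].
  destruct (lm_diff _ _ _ _ _ L t w) as (rho & Hr & E'); try lra.
  apply Rabs_le_between in Hr. destruct R as [Hh _ _ _].
  replace (g t - t) with (h * (w - t) * - (b + t + w + rho)) by (rewrite E in E'; lra).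
  assert (0 <= h * (w - t)) by nra.
  assert (- t / 10 <= - (b + t + w + rho)) by lra. nra.
Qed.

(** Near the origin the fixed point is compared through [0], near the fixed point
    directly: neither comparison is sharp enough on the whole interval. *)
Lemma left_drift_inner : forall e h a b g gi w t, ranges e h a b -> left_map e h b g gi ->
  left_fixpoint e g w -> w <= t <= 0 ->
  h * - t * (t - w) / 10 <= t - g t.
Proof.
  intros e h a b g gi w t R L Fw Ht.
  assert (Hb := left_fixpoint_bounds _ _ _ _ _ _ _ R L Fw). destruct Fw as [Hw E].
  destruct R as [Hh _ _ _].
  destruct (Rle_dec t (w / 2)) as [C|C].
  - destruct (lm_diff _ _ _ _ _ L w t) as (rho & Hr & E'); try lra.
    apply Rabs_le_between in Hr.
    replace (t - g t) with (h * (t - w) * - (b + t + w + rho)) by (rewrite E in E'; lra).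
    assert (0 <= h * (t - w)) by nra.
    assert (- t / 10 <= - (b + t + w + rho)) by lra. nra.
  - destruct (left_map_at _ _ _ _ _ t L) as (rho & Hr & E'); [lra|].
    apply Rabs_le_between in Hr.
    replace (t - g t) with (h * - t * (b + t + rho)) by lra.
    assert (0 <= h * - t) by nra.
    assert ((t - w) / 10 <= b + t + rho) by lra. nra.
Qed.

Lemma left_drift_nonpos : forall e h a b g gi t, ranges e h a b -> left_map e h b g gi ->
  a <= 0 -> -e <= t <= 0 -> h * t ^ 2 / 10 <= g t - t.
Proof.
  intros e h a b g gi t R L Ha Ht.
  assert (Hb := ranges_nonpos _ _ _ _ R Ha). destruct R as [Hh _ _ _].
  destruct (left_map_at _ _ _ _ _ t L) as (rho & Hr & E); [lra|].
  apply Rabs_le_between in Hr.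
  replace (g t - t) with (h * - t * - (b + t + rho)) by lra.
  replace (h * t ^ 2 / 10) with (h * - t * (- t / 10)) by field.
  apply Rmult_le_compat_l; nra.
Qed.

Lemma left_fixpoint_unique : forall e h a b g gi w t, ranges e h a b -> left_map e h b g gi ->
  left_fixpoint e g w -> left_fixpoint e g t -> t = w.
Proof.
  intros e h a b g gi w t R L Fw [Ht Et].
  assert (H1 := left_drift_outer _ _ _ _ _ _ w t R L Fw).
  assert (H2 := left_drift_inner _ _ _ _ _ _ w t R L Fw).
  destruct R as [Hh _ _ _]. destruct Fw as [Hw _].
  destruct (Rtotal_order t w) as [C|[C|C]]; [|assumption|].
  - specialize (H1 ltac:(lra)).
    assert (0 < h * - t) by nra. nra.
  - specialize (H2 ltac:(lra)).
    assert (0 < h * - t) by nra. nra.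
Qed.

(** * One step of the conjugacy *)

(** The error is cubic in [x], as the perturbation of a normal form is; with a bound
    uniform in [x] the estimates below would fail as [a] tends to [0], since the
    rates of contraction are only of order [h |x|] and [h a]. *)
Definition left_close (e h B : R) (g G : R -> R) : Prop :=
  forall x, -e <= x <= 0 -> Rabs (G x - g x) <= B * h * (- x) ^ 3.

Lemma left_diff : forall e h b g gi x y, left_map e h b g gi ->
  -e <= x <= 0 -> -e <= y <= 0 ->
  exists rho, Rabs rho <= 11 / 50 * Rmax (- x) (- y) /\
    g y - g x = (y - x) * (1 + h * (b + x + y + rho)).
Proof.
  intros e h b g gi x y L Hx Hy.
  destruct (Rle_dec x y) as [C|C].
  - rewrite Rmax_left by lra. apply (lm_diff _ _ _ _ _ L); lra.
  - rewrite Rmax_right by lra.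
    destruct (lm_diff _ _ _ _ _ L y x) as (rho & Hr & E); try lra.
    exists rho. split; [assumption|].
    replace (b + x + y + rho) with (b + y + x + rho) by ring. lra.
Qed.

(** Beyond the fixed point [g] and [G] contract: there [b] is at most [61 / 100] of
    [|x| + |y|], so the difference quotient is at most [1 - h (|x| + |y|) / 10], and
    this gain pays for the error [B h |x|^3] of one step. *)
Lemma step_outer : forall e h a b g gi G Gi B x y,
  ranges e h a b -> left_map e h b g gi -> left_map e h b G Gi ->
  0 <= B -> left_close e h B g G ->
  -e <= x <= 0 -> -e <= y <= 0 -> b <= 61 / 50 * - x -> b <= 61 / 50 * - y ->
  Rabs (x - y) <= 20 * B -> Rabs (g x - G y) <= 20 * B.
Proof.
  intros e h a b g gi G Gi B x y R Lg LG HB HC Hx Hy Bx By Hxy.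
  destruct (left_diff _ _ _ _ _ x y LG Hx Hy) as (rho & Hr & E).
  specialize (HC x Hx).
  assert (Hb := ranges_bounds _ _ _ _ R). destruct R as [Hh He _ _].
  assert (Hr' : Rabs rho <= 11 / 50 * (- x + - y)).
  { eapply Rle_trans; [exact Hr|]. unfold Rmax; destruct Rle_dec; lra. }
  apply Rabs_le_between in Hr'.
  set (s := - x + - y) in *.
  set (q := b + x + y + rho) in *.
  assert (Hq : -1/2 <= q <= - s / 10) by (unfold q, s in *; lra).
  assert (H1 : 0 <= 1 + h * q) by nra.
  assert (H2 : h * q <= - (h * s) / 10) by nra.
  replace (g x - G y) with ((x - y) * (1 + h * q) + - (G x - g x)) by lra.
  eapply Rle_trans; [apply Rabs_triang|].
  rewrite Rabs_Ropp, Rabs_mult, (Rabs_pos_eq (1 + h * q)) by lra.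
  assert (Hs : 0 <= h * s) by (unfold s; nra).
  assert (H3 : Rabs (x - y) * (1 + h * q) <= 20 * B * (1 + h * q)) by nra.
  assert (H4 : B * (h * q) <= B * (- (h * s) / 10)) by nra.
  assert (H5 : B * h * (- x) ^ 3 <= B * h * s).
  { apply Rmult_le_compat_l; [nra|]. unfold s. assert (0 <= (-x)^2 <= 1) by nra. nra. }
  nra.
Qed.

(** The factor by which [G] changes [1 / x - 1 / y], where [ux], [uy] are the
    relative displacements of [x], [y] and [uq] that of [x - y].  The terms linear in
    [x] and [y] nearly cancel in [uq - ux - uy] and leave [- h b]. *)
Lemma contraction_ratio : forall u ux uy uq, 0 < u <= 1 / 200 ->
  - u <= ux <= u -> - u <= uy <= u -> uq - ux - uy <= - u * (3 / 20) -> -1/10 <= uq ->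
  0 <= (1 + uq) / ((1 + ux) * (1 + uy)) <= 1 - u / 10.
Proof.
  intros u ux uy uq Hu Hx Hy Hq Hq1.
  set (d := (1 + ux) * (1 + uy)).
  assert (D1 : 0 < d) by (apply Rmult_lt_0_compat; lra).
  assert (D2 : d <= 51 / 50).
  { apply Rle_trans with ((1 + 1 / 200) * (1 + 1 / 200)); [|lra].
    apply Rmult_le_compat; lra. }
  assert (D3 : 1 + ux + uy - u * u <= d).
  { assert (H1 : 0 <= (u + ux) * (u + uy)) by (apply Rmult_le_pos; lra).
    assert (H2 : 0 <= (u - ux) * (u - uy)) by (apply Rmult_le_pos; lra).
    unfold d. lra. }
  assert (D4 : u * d <= u * (51 / 50)) by (apply Rmult_le_compat_l; lra).
  assert (D5 : u * u <= u * (1 / 200)) by (apply Rmult_le_compat_l; lra).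
  clearbody d. split.
  - apply Rdiv_le_0_compat; lra.
  - apply Rle_div_l; lra.
Qed.

(** Between the fixed point and [- a / 3] the maps expand at first and contract only
    later, so [|x - y|] is no good quantity.  But in the coordinate [v = 1 / x] the
    equation [x' = a x + x^2] becomes [v' = - a v - 1], which contracts at the
    constant rate [a], and the error of one step, divided by [x^2], is of order
    [B h |x|], that is, of order [B h a]. *)
Lemma step_inner_down : forall e h a b g gi G Gi B x y,
  ranges e h a b -> left_map e h b g gi -> left_map e h b G Gi ->
  0 <= B -> left_close e h B g G ->
  -e <= x < 0 -> -e <= y < 0 -> 39 / 50 * - x <= b -> 39 / 50 * - y <= b ->
  Rabs (/ x - / y) <= 20 * B -> Rabs (/ g x - / G y) <= 20 * B.
Proof.
  intros e h a b g gi G Gi B x y R Lg LG HB HC Hx Hy Bx By Hxy.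
  destruct (left_diff _ _ _ _ _ x y LG) as (rho & Hr & E); try lra.
  destruct (left_map_at _ _ _ _ _ x LG) as (rx & Hrx & Ex); try lra.
  destruct (left_map_at _ _ _ _ _ y LG) as (ry & Hry & Ey); try lra.
  destruct (left_map_at _ _ _ _ _ x Lg) as (rg & Hrg & Eg); try lra.
  specialize (HC x ltac:(lra)).
  assert (Hb := ranges_bounds _ _ _ _ R). destruct R as [Hh He _ _].
  assert (Hr' : Rabs rho <= 11 / 50 * (50 / 39 * b)).
  { eapply Rle_trans; [exact Hr|]. unfold Rmax; destruct Rle_dec; lra. }
  apply Rabs_le_between in Hr'. apply Rabs_le_between in Hrx.
  apply Rabs_le_between in Hry. apply Rabs_le_between in Hrg.
  set (qx := b + x + rx) in *. set (qy := b + y + ry) in *. set (qg := b + x + rg) in *.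
  set (q := b + x + y + rho) in *.
  assert (Hqx : - b <= qx <= b) by (unfold qx; lra).
  assert (Hqy : - b <= qy <= b) by (unfold qy; lra).
  assert (Hqg : - b <= qg <= b) by (unfold qg; lra).
  assert (Hq : q - qx - qy <= - b * (3 / 20)) by (unfold q, qx, qy; lra).
  assert (Hq1 : -1/2 <= q) by (unfold q; lra).
  clearbody q qx qy qg.
  assert (Hhb : 0 < h * b <= 1 / 200) by nra.
  assert (Px : - (h * b) <= h * qx <= h * b) by nra.
  assert (Py : - (h * b) <= h * qy <= h * b) by nra.
  assert (Pg : - (h * b) <= h * qg <= h * b) by nra.
  assert (P : h * q - h * qx - h * qy <= - (h * b) * (3 / 20)) by nra.
  assert (P1 : -1/10 <= h * q) by nra.
  set (u := h * b) in *. set (ux := h * qx) in *. set (uy := h * qy) in *.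
  set (ug := h * qg) in *. set (uq := h * q) in *.
  assert (Hcontr := contraction_ratio u ux uy uq Hhb Px Py P P1).
  (* The cubic error divided by [x ^ 2]; [|x|] is then bounded by a multiple of [b]. *)
  assert (Herr : Rabs (/ g x - / G x) <= 2 * B * u).
  { rewrite Eg, Ex.
    replace (/ (x * (1 + ug)) - / (x * (1 + ux)))
      with ((x * (1 + ux) - x * (1 + ug)) * / (x ^ 2 * ((1 + ux) * (1 + ug))))
      by (field; repeat split; lra).
    rewrite <- Ex, <- Eg, Rabs_mult.
    assert (D : 9 / 10 <= (1 + ux) * (1 + ug)).
    { apply Rle_trans with ((1 - 1 / 200) * (1 - 1 / 200)); [lra|].
      apply Rmult_le_compat; lra. }
    assert (D1 : 0 < x ^ 2) by (apply pow2_gt_0; lra).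
    set (d := (1 + ux) * (1 + ug)) in *.
    rewrite (Rabs_pos_eq (/ _))
      by (left; apply Rinv_0_lt_compat, Rmult_lt_0_compat; lra).
    apply Rle_div_l; [apply Rmult_lt_0_compat; lra|].
    eapply Rle_trans; [exact HC|].
    replace (2 * B * u * (x ^ 2 * d)) with (B * h * x ^ 2 * (2 * b * d))
      by (unfold u; ring).
    replace (B * h * (- x) ^ 3) with (B * h * x ^ 2 * - x) by ring.
    apply Rmult_le_compat_l.
    - apply Rmult_le_pos; [apply Rmult_le_pos|]; lra.
    - assert (2 * b * (9 / 10) <= 2 * b * d) by (apply Rmult_le_compat_l; lra). lra. }
  replace (/ g x - / G y) with
    ((/ x - / y) * ((1 + uq) / ((1 + ux) * (1 + uy))) + (/ g x - / G x)).
  - eapply Rle_trans; [apply Rabs_triang|].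
    rewrite Rabs_mult, (Rabs_pos_eq (_ / _)) by lra.
    set (k := (1 + uq) / ((1 + ux) * (1 + uy))) in *. clearbody k.
    assert (Rabs (/ x - / y) * k <= 20 * B * (1 - u / 10))
      by (apply Rmult_le_compat; try lra; apply Rabs_pos).
    lra.
  - assert (E' : / G x - / G y = (/ x - / y) * ((1 + uq) / ((1 + ux) * (1 + uy)))).
    { replace (/ G x - / G y) with ((G y - G x) / (G x * G y)).
      - rewrite E, Ex, Ey. field. repeat split; lra.
      - field. rewrite Ex, Ey.
        split; apply Rmult_integral_contrapositive_currified; lra. }
    lra.
Qed.

(** Between [- a / 3] and the origin both maps expand at a rate of order [h a], so
    their inverses contract. *)
Lemma step_inner_up : forall e h a b g gi G Gi B x y,
  ranges e h a b -> left_map e h b g gi -> left_map e h b G Gi ->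
  0 <= B -> left_close e h B g G -> 0 < a ->
  - a / 3 <= x <= 0 -> - a / 3 <= y <= 0 ->
  Rabs (g x - G y) <= 20 * B -> Rabs (x - y) <= 20 * B.
Proof.
  intros e h a b g gi G Gi B x y R Lg LG HB HC Ha Hx Hy Hxy.
  assert (Hb := ranges_pos _ _ _ _ R Ha).
  destruct (left_diff _ _ _ _ _ x y LG) as (rho & Hr & E); try lra.
  specialize (HC x ltac:(lra)). destruct R as [Hh He _ _].
  assert (Hr' : Rabs rho <= 11 / 50 * (a / 3)).
  { eapply Rle_trans; [exact Hr|]. unfold Rmax; destruct Rle_dec; lra. }
  apply Rabs_le_between in Hr'.
  set (q := b + x + y + rho) in *.
  assert (Hq : a / 10 <= q) by (unfold q; lra).
  assert (H1 : h * a / 10 <= h * q) by nra.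
  assert (H2 : Rabs (x - y) * (1 + h * q) <= 20 * B + B * h * (- x) ^ 3).
  { assert (0 < h * a) by nra.
    rewrite <- (Rabs_pos_eq (1 + h * q)), <- Rabs_mult by lra.
    replace ((x - y) * (1 + h * q)) with ((g x - G y) + (G x - g x)) by lra.
    eapply Rle_trans; [apply Rabs_triang|]. lra. }
  assert (H3 : B * h * (- x) ^ 3 <= B * h * a).
  { apply Rmult_le_compat_l; [nra|]. assert (0 <= (-x)^2 <= 1) by nra. nra. }
  assert (H4 : 0 < h * a) by nra.
  assert (H5 : Rabs (x - y) * (1 + h * a / 10) <= 20 * B + B * (h * a)).
  { assert (H := Rabs_pos (x - y)). nra. }
  apply Rmult_le_reg_r with (1 + h * a / 10); nra.
Qed.

(** At the fixed point [w] of [g] the drift of [G] is [G w - g w], which the lower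
    bound on the drift turns into a bound for the distance to [W]. *)
Lemma left_fixpoints_close : forall e h a b g G Gi B w W,
  ranges e h a b -> left_map e h b G Gi ->
  0 <= B -> left_close e h B g G ->
  left_fixpoint e g w -> left_fixpoint e G W -> Rabs (w - W) <= 20 * B.
Proof.
  intros e h a b g G Gi B w W R LG HB HC [Hw Ew] FW.
  specialize (HC w ltac:(lra)). rewrite Ew in HC.
  assert (H1 := left_drift_outer _ _ _ _ _ _ W w R LG FW).
  assert (H2 := left_drift_inner _ _ _ _ _ _ W w R LG FW).
  destruct R as [Hh He _ _]. destruct FW as [HW _].
  assert (H3 : h * - w * (Rabs (w - W) / 10) <= h * - w * (B * w ^ 2)).
  { replace (h * - w * (B * w ^ 2)) with (B * h * (- w) ^ 3) by ring.
    apply Rabs_le_between in HC.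
    destruct (Rle_dec w W) as [C|C].
    - rewrite Rabs_left1 by lra. specialize (H1 ltac:(lra)). lra.
    - rewrite Rabs_pos_eq by lra. specialize (H2 ltac:(lra)). lra. }
  apply Rmult_le_reg_l in H3; [|nra].
  assert (B * w ^ 2 <= B * 1) by (apply Rmult_le_compat_l; nra). lra.
Qed.

(** * The conjugacy on the negative half-line *)

(** The half of the conjugacy over [x <= 0].  The inverses [gi], [Gi] are arguments
    of their own, so that the other half is the same relation for the reflected
    maps, with the maps and their inverses exchanged. *)
Inductive left_graph (g gi G Gi : R -> R) (e a : R) | : R -> R -> Prop :=
| lg_zero : left_graph 0 0
| lg_fix : forall w W, 0 < a -> left_fixpoint e g w -> left_fixpoint e G W ->
    left_graph w W
| lg_in_base : forall x, 0 < a -> g (- a / 3) <= x <= - a / 3 ->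
    left_graph x (affine (g (- a / 3)) (G (- a / 3)) (- a / 3) (- a / 3) x)
| lg_in_down : forall n x y, 0 < a -> (1 <= n)%nat ->
    Nat.iter (S n) g (- a / 3) <= x <= Nat.iter n g (- a / 3) ->
    left_graph (gi x) y -> left_graph x (G y)
| lg_in_up : forall n x y, 0 < a ->
    Nat.iter n gi (- a / 3) <= x <= Nat.iter (S n) gi (- a / 3) ->
    left_graph (g x) y -> left_graph x (Gi y)
| lg_out_base : forall x, - e <= x <= g (- e) ->
    left_graph x (affine (- e) (- e) (g (- e)) (G (- e)) x)
| lg_out_up : forall n x y, (1 <= n)%nat ->
    Nat.iter n g (- e) <= x <= Nat.iter (S n) g (- e) ->
    left_graph (gi x) y -> left_graph x (G y).

Record left_pair (e h a b B : R) (g gi G Gi : R -> R) : Prop := {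
  lp_ranges : ranges e h a b;
  lp_g : left_map e h b g gi;
  lp_G : left_map e h b G Gi;
  lp_B : 0 <= B;
  lp_close : left_close e h B g G }.

Lemma affine_spec : forall u u' v v' x, u < v -> u <= x <= v ->
  exists t, 0 <= t <= 1 /\ x = u + (v - u) * t /\ affine u u' v v' x = u' + (v' - u') * t.
Proof.
  intros u u' v v' x Huv Hx. exists ((x - u) / (v - u)). split; [|split].
  - split.
    + apply Rdiv_le_0_compat; lra.
    + apply Rle_div_l; lra.
  - field; lra.
  - unfold affine. field; lra.
Qed.

Lemma left_map_reflect_le : forall e h a b g gi x y, ranges e h a b -> left_map e h b g gi ->
  -e <= x <= 0 -> -e <= y <= 0 -> g x <= g y -> x <= y.
Proof.
  intros e h a b g gi x y R L Hx Hy H.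
  destruct (Rle_dec x y) as [C|C]; [assumption|].
  assert (H1 := left_map_increasing _ _ _ _ _ _ y x R L). lra.
Qed.

Lemma left_map_reflect_lt : forall e h a b g gi x y, ranges e h a b -> left_map e h b g gi ->
  -e <= x <= 0 -> -e <= y <= 0 -> g x < g y -> x < y.
Proof.
  intros e h a b g gi x y R L Hx Hy H.
  destruct (Rlt_dec x y) as [C|C]; [assumption|].
  assert (H1 := left_map_nondecreasing _ _ _ _ _ _ y x R L). lra.
Qed.

Lemma left_inverse : forall e h a b g gi y, ranges e h a b -> left_map e h b g gi ->
  g (-e) <= y < 0 -> -e <= gi y < 0 /\ g (gi y) = y.
Proof.
  intros e h a b g gi y R L Hy.
  destruct (lm_inv_r _ _ _ _ _ L y) as [H1 H2]; [lra|].
  destruct (Req_dec (gi y) 0) as [E|E].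
  - rewrite E, (lm_zero _ _ _ _ _ L) in H2. lra.
  - lra.
Qed.

Lemma left_fixpoint_order : forall e h a b g gi w, ranges e h a b -> left_map e h b g gi ->
  0 < a -> left_fixpoint e g w -> g (-e) <= w /\ w < g (- a / 3) < - a / 3 /\ -e < - a / 3.
Proof.
  intros e h a b g gi w R L Ha F.
  assert (Hb := left_fixpoint_bounds _ _ _ _ _ _ _ R L F).
  assert (Hb' := ranges_pos _ _ _ _ R Ha).
  assert (D := left_drift_inner _ _ _ _ _ _ w (- a / 3) R L F).
  destruct F as [Hw E].
  assert (H1 := left_map_nondecreasing _ _ _ _ _ _ (-e) w R L).
  assert (H2 := left_map_increasing _ _ _ _ _ _ w (-a/3) R L).
  specialize (D ltac:(lra)).
  assert (0 < h * - (- a / 3) * (- a / 3 - w) / 10).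
  { destruct R as [Hh _ _ _]. repeat apply Rmult_lt_0_compat; lra. }
  repeat split; lra.
Qed.

Lemma left_outer_forward : forall e h a b g gi w x, ranges e h a b -> left_map e h b g gi ->
  left_fixpoint e g w -> -e <= x < w -> -e <= g x < w.
Proof.
  intros e h a b g gi w x R L [Hw E] Hx.
  assert (H1 := left_map_range _ _ _ _ _ _ x R L).
  assert (H2 := left_map_increasing _ _ _ _ _ _ x w R L). lra.
Qed.

Lemma left_inner_forward : forall e h a b g gi w x, ranges e h a b -> left_map e h b g gi ->
  left_fixpoint e g w -> w < x < 0 -> w < g x <= x.
Proof.
  intros e h a b g gi w x R L F Hx.
  assert (D := left_drift_inner _ _ _ _ _ _ w x R L F).
  destruct F as [Hw E].
  assert (H2 := left_map_increasing _ _ _ _ _ _ w x R L).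
  assert (0 < h * - x * (x - w) / 10).
  { destruct R as [Hh _ _ _]. repeat apply Rmult_lt_0_compat; lra. }
  lra.
Qed.

Lemma left_inner_backward : forall e h a b g gi w x, ranges e h a b -> left_map e h b g gi ->
  left_fixpoint e g w -> w < x < 0 -> x <= gi x < 0 /\ g (gi x) = x.
Proof.
  intros e h a b g gi w x R L F Hx.
  assert (F' := F). destruct F' as [Hw E].
  assert (H1 := left_map_nondecreasing _ _ _ _ _ _ (-e) w R L).
  destruct (left_inverse _ _ _ _ _ _ x R L) as [H2 H3]; [lra|].
  assert (H4 := left_map_reflect_lt _ _ _ _ _ _ w (gi x) R L).
  assert (H5 := left_inner_forward _ _ _ _ _ _ w (gi x) R L F).
  lra.
Qed.

Lemma iter_invariant : forall (P : R -> Prop) (f : R -> R) x,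
  P x -> (forall t, P t -> P (f t)) -> forall n, P (Nat.iter n f x).
Proof.
  intros P f x H0 Hs n. induction n as [|n IH]; [exact H0|]. simpl. auto.
Qed.

Lemma iter_outer : forall e h a b g gi w n, ranges e h a b -> left_map e h b g gi ->
  0 < a -> left_fixpoint e g w -> -e <= Nat.iter n g (-e) < w.
Proof.
  intros e h a b g gi w n R L Ha F.
  apply (iter_invariant (fun t => -e <= t < w)).
  - assert (H := left_fixpoint_order _ _ _ _ _ _ _ R L Ha F).
    assert (H1 := left_map_edge _ _ _ _ _ _ R L). lra.
  - intros t Ht. eapply left_outer_forward; eauto.
Qed.

Lemma iter_outer_nonpos : forall e h a b g gi n, ranges e h a b -> left_map e h b g gi ->
  -e <= Nat.iter n g (-e) < 0.
Proof.
  intros e h a b g gi n R L.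
  apply (iter_invariant (fun t => -e <= t < 0)).
  - destruct R as [_ He _ _]. lra.
  - intros t Ht. assert (H := left_map_range _ _ _ _ _ _ t R L Ht). lra.
Qed.

Lemma iter_inner_down : forall e h a b g gi w n, ranges e h a b -> left_map e h b g gi ->
  0 < a -> left_fixpoint e g w -> w < Nat.iter n g (- a / 3) <= - a / 3.
Proof.
  intros e h a b g gi w n R L Ha F.
  apply (iter_invariant (fun t => w < t <= - a / 3)).
  - assert (H := left_fixpoint_order _ _ _ _ _ _ _ R L Ha F). lra.
  - intros t Ht. assert (H := left_inner_forward _ _ _ _ _ _ w t R L F ltac:(lra)). lra.
Qed.

Lemma iter_inner_up : forall e h a b g gi w n, ranges e h a b -> left_map e h b g gi ->
  0 < a -> left_fixpoint e g w -> - a / 3 <= Nat.iter n gi (- a / 3) < 0.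
Proof.
  intros e h a b g gi w n R L Ha F.
  assert (H := left_fixpoint_order _ _ _ _ _ _ _ R L Ha F).
  apply (iter_invariant (fun t => - a / 3 <= t < 0)).
  - lra.
  - intros t Ht. assert (H1 := left_inner_backward _ _ _ _ _ _ w t R L F ltac:(lra)). lra.
Qed.

(** What the recursion preserves when [a > 0], each region having the measure of
    distance that one step contracts there.  The order conditions keep [y] in the
    region that corresponds to the one of [x]; those at [- a / 3] and at its image
    determine [y] at the two ends of the inner fundamental interval, where a point
    is reached by both of the inner recursions. *)
Record inner_outer_close (e D a : R) (g G : R -> R) (w W x y : R) : Prop := {
  io_x : -e <= x <= 0;
  io_y : -e <= y <= 0;
  io_neg : x < 0 -> y < 0;
  io_out : x < w -> y < W /\ Rabs (x - y) <= D;
  io_fix : x = w -> y = W;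
  io_in : w < x -> W < y;
  io_down : w < x <= - a / 3 -> y <= - a / 3 /\ Rabs (/ x - / y) <= D;
  io_below : w < x <= g (- a / 3) -> y <= G (- a / 3);
  io_up : g (- a / 3) <= x -> G (- a / 3) <= y /\ Rabs (x - y) <= D;
  io_above : - a / 3 <= x -> - a / 3 <= y }.

Lemma close_of_inv_close : forall x y D, 0 <= D -> -1 <= x < 0 -> -1 <= y < 0 ->
  Rabs (/ x - / y) <= D -> Rabs (x - y) <= D.
Proof.
  intros x y D HD Hx Hy H.
  replace (x - y) with (- (x * y * (/ x - / y))) by (field; lra).
  rewrite Rabs_Ropp, Rabs_mult.
  assert (H1 : 0 <= x * y <= 1) by nra.
  rewrite (Rabs_pos_eq (x * y)) by lra.
  assert (H2 := Rabs_pos (/ x - / y)). nra.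
Qed.

Lemma inv_close_of_close : forall x y s D, 0 < s -> x <= - s -> y <= - s ->
  Rabs (x - y) <= D * s ^ 2 -> Rabs (/ x - / y) <= D.
Proof.
  intros x y s D Hs Hx Hy H.
  replace (/ x - / y) with (- ((x - y) * / (x * y))) by (field; lra).
  assert (H1 : s ^ 2 <= x * y) by nra.
  assert (H0 : 0 < s ^ 2) by (apply pow2_gt_0; lra).
  rewrite Rabs_Ropp, Rabs_mult, (Rabs_pos_eq (/ _))
    by (left; apply Rinv_0_lt_compat; lra).
  apply Rle_div_l; [lra|].
  assert (0 <= D).
  { assert (H2 := Rabs_pos (x - y)). nra. }
  nra.
Qed.

(** Induction on the construction, by the step estimate of each region; on the
    fundamental intervals the two affine parametrizations differ only by the
    difference of [g] and [G] at one endpoint. *)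
Lemma left_graph_pos_close : forall e h a b B g gi G Gi w W x y,
  left_pair e h a b B g gi G Gi -> 0 < a ->
  left_fixpoint e g w -> left_fixpoint e G W ->
  left_graph g gi G Gi e a x y ->
  inner_outer_close e (20 * B) a g G w W x y.
Proof.
  intros e h a b B g gi G Gi w W x y [R Lg LG HB HC] Ha Fw FW HJ.
  assert (Ow := left_fixpoint_order _ _ _ _ _ _ _ R Lg Ha Fw).
  assert (OW := left_fixpoint_order _ _ _ _ _ _ _ R LG Ha FW).
  assert (He := rg_e _ _ _ _ R).
  assert (Hh := rg_h _ _ _ _ R).
  assert (Bw := left_fixpoint_bounds _ _ _ _ _ _ _ R Lg Fw).
  assert (BW := left_fixpoint_bounds _ _ _ _ _ _ _ R LG FW).
  assert (Hw := proj1 Fw). assert (HW := proj1 FW).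
  assert (Ew := proj2 Fw). assert (EW := proj2 FW).
  induction HJ as [|w' W' _ Fw' FW'|x _ Hx|n x y _ Hn Hx HJ IH|n x y _ Hx HJ IH|x Hx
    |n x y Hn Hx HJ IH].
  - constructor; intros; try lra; try (exfalso; lra).
    rewrite Rminus_0_r, Rabs_R0. lra.
  - rewrite (left_fixpoint_unique _ _ _ _ _ _ _ _ R Lg Fw Fw').
    rewrite (left_fixpoint_unique _ _ _ _ _ _ _ _ R LG FW FW').
    constructor; intros; solve [lra | exfalso; lra].
  - assert (Hx0' : - a / 3 < 0) by lra. set (x0 := - a / 3) in *.
    destruct (affine_spec (g x0) (G x0) x0 x0 x) as (t & Ht & Ex & Ey); try lra.
    rewrite Ey. set (y := G x0 + (x0 - G x0) * t) in *.
    assert (Hy : G x0 <= y <= x0) by (unfold y; nra).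
    assert (Hxy : Rabs (x - y) <= B * h * (- x0) ^ 3).
    { replace (x - y) with (- ((G x0 - g x0) * (1 - t))) by (rewrite Ex at 1; unfold y; ring).
      rewrite Rabs_Ropp, Rabs_mult, (Rabs_pos_eq (1 - t)) by lra.
      specialize (HC x0 ltac:(lra)). assert (H := Rabs_pos (G x0 - g x0)). nra. }
    assert (Hx0 : 0 < - x0 <= 1) by (unfold x0 in *; lra).
    assert (Hxy' : Rabs (x - y) <= 20 * B * (- x0) ^ 2).
    { eapply Rle_trans; [exact Hxy|].
      replace (B * h * (- x0) ^ 3) with (B * (- x0) ^ 2 * (h * - x0)) by ring.
      assert (0 <= B * (- x0) ^ 2) by (apply Rmult_le_pos; [lra|apply pow2_ge_0]).
      assert (h * - x0 <= 1) by nra. nra. }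
    constructor; fold x0; intros; try lra; try (exfalso; lra).
    + split; [lra|]. eapply inv_close_of_close with (s := - x0); lra.
    + assert (E : x = g x0) by lra. rewrite E in Ex.
      assert (t = 0) by nra. unfold y. subst t. lra.
    + split; [lra|]. eapply Rle_trans; [exact Hxy'|].
      assert (0 <= (- x0) ^ 2 <= 1) by nra. nra.
    + assert (E : x = x0) by lra. rewrite E in Ex at 1.
      assert (t = 1) by nra. unfold y. subst t. lra.
  - destruct n as [|n]; [lia|]. 
    assert (Hi := iter_inner_down _ _ _ _ _ _ _ (S (S n)) R Lg Ha Fw).
    assert (Hi' := iter_inner_down _ _ _ _ _ _ _ n R Lg Ha Fw).
    assert (Hxg : x <= g (- a / 3)).
    { eapply Rle_trans; [apply Hx|]. simpl.
      apply (left_map_nondecreasing _ _ _ _ _ _ _ _ R Lg); lra. }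
    destruct (left_inverse _ _ _ _ _ _ x R Lg) as [Hu Eu]; [lra|].
    set (u := gi x) in *. clearbody u. subst x.
    assert (Hu1 : w < u) by (apply (left_map_reflect_lt _ _ _ _ _ _ _ _ R Lg); lra).
    assert (Hu2 : u <= - a / 3) by (apply (left_map_reflect_le _ _ _ _ _ _ _ _ R Lg); lra).
    destruct IH as [_ Hy _ _ _ I1 I2 _ _ I5].
    specialize (I1 Hu1). destruct (I2 (conj Hu1 Hu2)) as [I3 I4].
    assert (Gy := left_inner_forward _ _ _ _ _ _ W y R LG FW ltac:(lra)).
    assert (Hinv : Rabs (/ g u - / G y) <= 20 * B)
      by (apply (step_inner_down _ _ _ _ _ _ _ _ _ _ _ R Lg LG HB HC); lra).
    assert (Gy' : G y <= G (- a / 3))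
      by (apply (left_map_nondecreasing _ _ _ _ _ _ _ _ R LG); lra).
    constructor; intros; try lra; try (exfalso; lra).
    split; [|apply close_of_inv_close; lra].
    apply (left_map_nondecreasing _ _ _ _ _ _ _ _ R LG); try lra.
    apply I5, (left_map_reflect_le _ _ _ _ _ _ _ _ R Lg); lra.
  - assert (Hi := iter_inner_up _ _ _ _ _ _ _ (S n) R Lg Ha Fw).
    assert (Hi' := iter_inner_up _ _ _ _ _ _ _ n R Lg Ha Fw).
    assert (Gx : g (- a / 3) <= g x)
      by (apply (left_map_nondecreasing _ _ _ _ _ _ _ _ R Lg); lra).
    assert (Gx' := left_inner_forward _ _ _ _ _ _ w x R Lg Fw ltac:(lra)).
    destruct IH as [_ _ In _ _ _ _ I1 I2 _].
    specialize (In ltac:(lra)). destruct (I2 Gx) as [I3 I4].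
    destruct (left_inverse _ _ _ _ _ _ y R LG) as [Hv Ev]; [lra|].
    set (v := Gi y) in *. clearbody v. subst y.
    assert (Hv' : - a / 3 <= v) by (apply (left_map_reflect_le _ _ _ _ _ _ _ _ R LG); lra).
    assert (Hxv : Rabs (x - v) <= 20 * B)
      by (apply (step_inner_up _ _ _ _ _ _ _ _ _ _ _ R Lg LG HB HC Ha); lra).
    constructor; intros; try lra; try (exfalso; lra).
    (* Only [x = - a / 3] belongs to both inner parts, and there [v = x]. *)
    assert (Ex : x = - a / 3) by lra.
    assert (Hv2 : v <= - a / 3).
    { apply (left_map_reflect_le _ _ _ _ _ _ _ _ R LG); try lra. apply I1.
      rewrite Ex. lra. }
    split; [assumption|].
    replace v with x by lra. rewrite Rminus_diag, Rabs_R0. lra.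
  - assert (Hi := iter_outer _ _ _ _ _ _ _ 1 R Lg Ha Fw). simpl in Hi.
    assert (HI := iter_outer _ _ _ _ _ _ _ 1 R LG Ha FW). simpl in HI.
    assert (Hg := left_map_edge _ _ _ _ _ _ R Lg).
    assert (HG := left_map_edge _ _ _ _ _ _ R LG).
    destruct (affine_spec (-e) (-e) (g (-e)) (G (-e)) x) as (t & Ht & Ex & Ey); try lra.
    rewrite Ey. set (y := -e + (G (-e) - -e) * t) in *.
    assert (Hy : -e <= y <= G (-e)) by (unfold y; nra).
    assert (Hxy : Rabs (x - y) <= 20 * B).
    { replace (x - y) with (- ((G (-e) - g (-e)) * t)) by (rewrite Ex at 1; unfold y; ring).
      rewrite Rabs_Ropp, Rabs_mult, (Rabs_pos_eq t) by lra.
      specialize (HC (-e) ltac:(lra)). assert (H := Rabs_pos (G (-e) - g (-e))).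
      assert (h * (- - e) ^ 3 <= 1 * 1)
        by (apply Rmult_le_compat; try lra; [apply pow_le; lra|];
            rewrite <- (pow1 3); apply pow_incr; lra).
      nra. }
    constructor; intros; solve [lra | exfalso; lra].
  - destruct n as [|n]; [lia|].
    assert (Hi := iter_outer _ _ _ _ _ _ _ (S (S n)) R Lg Ha Fw).
    assert (Hi' := iter_outer _ _ _ _ _ _ _ n R Lg Ha Fw).
    assert (Hgx : g (-e) <= x).
    { eapply Rle_trans; [|apply Hx]. simpl.
      apply (left_map_nondecreasing _ _ _ _ _ _ _ _ R Lg); lra. }
    destruct (left_inverse _ _ _ _ _ _ x R Lg) as [Hu Eu]; [lra|].
    set (u := gi x) in *. clearbody u. subst x.
    assert (Hu1 : u < w) by (apply (left_map_reflect_lt _ _ _ _ _ _ _ _ R Lg); lra).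
    destruct IH as [_ Hy _ I1 _ _ _ _ _ _].
    destruct (I1 Hu1) as [I2 I3].
    assert (Gy := left_outer_forward _ _ _ _ _ _ W y R LG FW ltac:(lra)).
    assert (Gu := left_outer_forward _ _ _ _ _ _ w u R Lg Fw ltac:(lra)).
    assert (Rabs (g u - G y) <= 20 * B)
      by (apply (step_outer _ _ _ _ _ _ _ _ _ _ _ R Lg LG HB HC); lra).
    constructor; intros; solve [lra | exfalso; lra].
Qed.

Record outer_close (e D x y : R) : Prop := {
  oc_y : -e <= y <= 0;
  oc_close : Rabs (x - y) <= D }.

Lemma left_graph_nonpos_close : forall e h a b B g gi G Gi x y,
  left_pair e h a b B g gi G Gi -> a <= 0 ->
  left_graph g gi G Gi e a x y -> outer_close e (20 * B) x y.
Proof.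
  intros e h a b B g gi G Gi x y [R Lg LG HB HC] Ha HJ.
  assert (He := rg_e _ _ _ _ R).
  assert (Hh := rg_h _ _ _ _ R).
  assert (Hb := ranges_nonpos _ _ _ _ R Ha).
  induction HJ as [| | | | |x Hx|n x y Hn Hx HJ IH]; try lra.
  - constructor; try lra. rewrite Rminus_0_r, Rabs_R0. lra.
  - assert (Hg := left_map_range _ _ _ _ _ _ (-e) R Lg).
    assert (HG := left_map_range _ _ _ _ _ _ (-e) R LG).
    destruct (affine_spec (-e) (-e) (g (-e)) (G (-e)) x) as (t & Ht & Ex & Ey); try lra.
    rewrite Ey. set (y := -e + (G (-e) - -e) * t) in *.
    assert (Hy : -e <= y <= G (-e)) by (unfold y; nra).
    constructor; try lra.
    replace (x - y) with (- ((G (-e) - g (-e)) * t)) by (rewrite Ex at 1; unfold y; ring).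
    rewrite Rabs_Ropp, Rabs_mult, (Rabs_pos_eq t) by lra.
    specialize (HC (-e) ltac:(lra)). assert (H := Rabs_pos (G (-e) - g (-e))).
    assert (h * (- - e) ^ 3 <= 1 * 1)
      by (apply Rmult_le_compat; try lra; [apply pow_le; lra|];
          rewrite <- (pow1 3); apply pow_incr; lra).
    nra.
  - destruct n as [|n]; [lia|].
    assert (Hi := iter_outer_nonpos _ _ _ _ _ _ (S (S n)) R Lg).
    assert (Hi' := iter_outer_nonpos _ _ _ _ _ _ n R Lg).
    assert (Hgx : g (-e) <= x).
    { eapply Rle_trans; [|apply Hx]. simpl.
      apply (left_map_nondecreasing _ _ _ _ _ _ _ _ R Lg); lra. }
    destruct (left_inverse _ _ _ _ _ _ x R Lg) as [Hu Eu]; [lra|].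
    set (u := gi x) in *. clearbody u. subst x.
    destruct IH as [Hy I1].
    assert (gE := left_map_edge _ _ _ _ _ _ R Lg).
    assert (GE := left_map_edge _ _ _ _ _ _ R LG).
    assert (G1 := left_map_nondecreasing _ _ _ _ _ _ (-e) y R LG).
    assert (G2 := left_map_nondecreasing _ _ _ _ _ _ y 0 R LG).
    rewrite (lm_zero _ _ _ _ _ LG) in G2.
    assert (Rabs (g u - G y) <= 20 * B)
      by (apply (step_outer _ _ _ _ _ _ _ _ _ _ _ R Lg LG HB HC); lra).
    constructor; lra.
Qed.

Lemma left_graph_close : forall e h a b B g gi G Gi x y,
  left_pair e h a b B g gi G Gi -> left_graph g gi G Gi e a x y -> Rabs (x - y) <= 20 * B.
Proof.
  intros e h a b B g gi G Gi x y P HJ.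
  destruct (Rlt_dec 0 a) as [Ha|Ha].
  - assert (P' := P). destruct P' as [R Lg LG HB HC].
    destruct (left_fixpoint_exists _ _ _ _ _ _ R Lg Ha) as [w Fw].
    destruct (left_fixpoint_exists _ _ _ _ _ _ R LG Ha) as [W FW].
    assert (Ow := left_fixpoint_order _ _ _ _ _ _ _ R Lg Ha Fw).
    assert (He := rg_e _ _ _ _ R). assert (HW := proj1 FW). assert (Hw := proj1 Fw).
    destruct (left_graph_pos_close _ _ _ _ _ _ _ _ _ w W x y P Ha Fw FW HJ)
      as [Hx Hy Hn I1 I2 I3 I4 _ I5 _].
    destruct (Rtotal_order x w) as [C|[C|C]].
    + apply I1, C.
    + rewrite (I2 C), C. eapply left_fixpoints_close; eauto.
    + destruct (Rle_dec x (- a / 3)) as [C'|C'].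
      * destruct (I4 (conj C C')) as [H1 H2]. apply close_of_inv_close; lra.
      * apply I5. lra.
  - eapply oc_close, left_graph_nonpos_close; eauto. lra.
Qed.

(** * Totality of the construction *)

Lemma left_graph_outer_total : forall e h a b B g gi G Gi n x,
  left_pair e h a b B g gi G Gi ->
  Nat.iter n g (-e) <= x <= Nat.iter (S n) g (-e) ->
  exists y, left_graph g gi G Gi e a x y.
Proof.
  intros e h a b B g gi G Gi n x [R Lg LG HB HC]. revert x.
  induction n as [|n IH]; intros x Hx.
  - eexists. apply lg_out_base. exact Hx.
  - assert (H0 := iter_outer_nonpos _ _ _ _ _ _ n R Lg).
    assert (H1 := iter_outer_nonpos _ _ _ _ _ _ (S n) R Lg).
    assert (H2 := iter_outer_nonpos _ _ _ _ _ _ (S (S n)) R Lg).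
    assert (Hgx : g (-e) <= x).
    { eapply Rle_trans; [|apply Hx]. simpl.
      apply (left_map_nondecreasing _ _ _ _ _ _ _ _ R Lg); lra. }
    destruct (left_inverse _ _ _ _ _ _ x R Lg) as [Hu Eu]; [lra|].
    destruct (IH (gi x)) as [y Hy].
    + split; apply (left_map_reflect_le _ _ _ _ _ _ _ _ R Lg); try lra; rewrite Eu; apply Hx.
    + exists (G y). eapply lg_out_up with (n := S n); eauto. lia.
Qed.

Lemma left_graph_down_total : forall e h a b B g gi G Gi n x,
  left_pair e h a b B g gi G Gi -> 0 < a ->
  Nat.iter (S n) g (- a / 3) <= x <= Nat.iter n g (- a / 3) ->
  exists y, left_graph g gi G Gi e a x y.
Proof.
  intros e h a b B g gi G Gi n x [R Lg LG HB HC] Ha.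
  destruct (left_fixpoint_exists _ _ _ _ _ _ R Lg Ha) as [w Fw].
  assert (Ow := left_fixpoint_order _ _ _ _ _ _ _ R Lg Ha Fw).
  assert (Hw := proj1 Fw). revert x.
  induction n as [|n IH]; intros x Hx.
  - eexists. apply lg_in_base; assumption.
  - assert (H0 := iter_inner_down _ _ _ _ _ _ _ n R Lg Ha Fw).
    assert (H1 := iter_inner_down _ _ _ _ _ _ _ (S n) R Lg Ha Fw).
    assert (H2 := iter_inner_down _ _ _ _ _ _ _ (S (S n)) R Lg Ha Fw).
    destruct (left_inner_backward _ _ _ _ _ _ w x R Lg Fw) as [Hu Eu]; [lra|].
    destruct (IH (gi x)) as [y Hy].
    + split; apply (left_map_reflect_le _ _ _ _ _ _ _ _ R Lg); try lra; rewrite Eu; apply Hx.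
    + exists (G y). eapply lg_in_down with (n := S n); eauto. lia.
Qed.

Lemma left_graph_up_total : forall e h a b B g gi G Gi n x,
  left_pair e h a b B g gi G Gi -> 0 < a ->
  Nat.iter n gi (- a / 3) <= x <= Nat.iter (S n) gi (- a / 3) ->
  exists y, left_graph g gi G Gi e a x y.
Proof.
  intros e h a b B g gi G Gi n x [R Lg LG HB HC] Ha.
  destruct (left_fixpoint_exists _ _ _ _ _ _ R Lg Ha) as [w Fw].
  assert (Ow := left_fixpoint_order _ _ _ _ _ _ _ R Lg Ha Fw).
  assert (Hw := proj1 Fw). revert x.
  assert (Hmono : forall m x, Nat.iter m gi (- a / 3) <= x <= Nat.iter (S m) gi (- a / 3) ->
    - a / 3 <= x < 0 /\ g (Nat.iter m gi (- a / 3)) <= g x <= Nat.iter m gi (- a / 3)).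
  { intros m x Hx.
    assert (H1 := iter_inner_up _ _ _ _ _ _ _ m R Lg Ha Fw).
    assert (H2 := iter_inner_up _ _ _ _ _ _ _ (S m) R Lg Ha Fw).
    split; [lra|].
    destruct (left_inner_backward _ _ _ _ _ _ w (Nat.iter m gi (- a / 3)) R Lg Fw)
      as [_ E]; [lra|].
    rewrite <- E at 2. simpl in Hx, H2.
    split; apply (left_map_nondecreasing _ _ _ _ _ _ _ _ R Lg); lra. }
  induction n as [|n IH]; intros x Hx; destruct (Hmono _ _ Hx) as [H1 H2].
  - eexists. eapply lg_in_up with (n := O); [assumption|exact Hx|].
    apply lg_in_base; [assumption|exact H2].
  - destruct (IH (g x)) as [y Hy].
    + destruct (left_inner_backward _ _ _ _ _ _ w (Nat.iter n gi (- a / 3)) R Lg Fw)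
        as [_ E].
      { assert (H3 := iter_inner_up _ _ _ _ _ _ _ n R Lg Ha Fw). lra. }
      simpl in H2. rewrite E in H2. exact H2.
    + exists (Gi y). eapply lg_in_up with (n := S n); eauto.
Qed.

(** The orbits that cut a region into fundamental intervals step over every one of
    its points, because the drift is bounded below before they reach that point. *)
Lemma left_graph_total : forall e h a b B g gi G Gi x,
  left_pair e h a b B g gi G Gi -> -e <= x <= 0 ->
  exists y, left_graph g gi G Gi e a x y.
Proof.
  intros e h a b B g gi G Gi x P Hx. assert (P' := P). destruct P' as [R Lg LG HB HC].
  assert (Hh := rg_h _ _ _ _ R).
  destruct (Req_dec x 0) as [->|Hx0]; [exists 0; apply lg_zero|].
  destruct (Rlt_dec 0 a) as [Ha|Ha].
  - destruct (left_fixpoint_exists _ _ _ _ _ _ R Lg Ha) as [w Fw].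
    destruct (left_fixpoint_exists _ _ _ _ _ _ R LG Ha) as [W FW].
    assert (Ow := left_fixpoint_order _ _ _ _ _ _ _ R Lg Ha Fw).
    assert (Hw := proj1 Fw).
    destruct (Rtotal_order x w) as [C|[C|C]].
    + destruct (staircase (fun n => Nat.iter n g (-e)) x (h * - x * (w - x) / 10))
        as [n Hn].
      * repeat apply Rmult_lt_0_compat; lra.
      * simpl. lra.
      * intros n H1 _.
        assert (H2 := iter_outer _ _ _ _ _ _ _ n R Lg Ha Fw).
        assert (D := left_drift_outer _ _ _ _ _ _ w (Nat.iter n g (-e)) R Lg Fw).
        specialize (D ltac:(lra)). simpl.
        set (t := Nat.iter n g (-e)) in *.
        assert (h * - x * (w - x) <= h * - t * (w - t)).
        { apply Rmult_le_compat; try lra; [nra|]. apply Rmult_le_compat_l; lra. }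
        lra.
      * eapply left_graph_outer_total; eauto.
    + subst x. exists W. apply lg_fix; assumption.
    + destruct (Rle_dec x (- a / 3)) as [C'|C'].
      * destruct (staircase (fun n => - Nat.iter n g (- a / 3)) (- x)
          (h * (a / 3) * (x - w) / 10)) as [n Hn].
        -- repeat apply Rmult_lt_0_compat; lra.
        -- simpl. lra.
        -- intros n H1 _.
           assert (H2 := iter_inner_down _ _ _ _ _ _ _ n R Lg Ha Fw).
           assert (D := left_drift_inner _ _ _ _ _ _ w (Nat.iter n g (- a / 3)) R Lg Fw).
           specialize (D ltac:(lra)). simpl.
           set (t := Nat.iter n g (- a / 3)) in *.
           assert (h * (a / 3) * (x - w) <= h * - t * (t - w)).
           { apply Rmult_le_compat; try lra; [nra|]. apply Rmult_le_compat_l; lra. }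
           lra.
        -- eapply left_graph_down_total with (n := n); eauto. lra.
      * destruct (staircase (fun n => Nat.iter n gi (- a / 3)) x
          (h * - x * (- a / 3 - w) / 10)) as [n Hn].
        -- repeat apply Rmult_lt_0_compat; lra.
        -- simpl. lra.
        -- intros n H1 H2.
           assert (H3 := iter_inner_up _ _ _ _ _ _ _ n R Lg Ha Fw).
           assert (H4 := iter_inner_up _ _ _ _ _ _ _ (S n) R Lg Ha Fw).
           assert (D := left_drift_inner _ _ _ _ _ _ w (Nat.iter (S n) gi (- a / 3)) R Lg Fw).
           specialize (D ltac:(lra)).
           destruct (left_inner_backward _ _ _ _ _ _ w (Nat.iter n gi (- a / 3)) R Lg Fw)
             as [_ E]; [lra|].
           change (gi (Nat.iter n gi (- a / 3))) with (Nat.iter (S n) gi (- a / 3)) in E.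
           rewrite E in D.
           set (t := Nat.iter (S n) gi (- a / 3)) in *.
           assert (h * - x * (- a / 3 - w) <= h * - t * (t - w)).
           { apply Rmult_le_compat; try lra; [nra|]. apply Rmult_le_compat_l; lra. }
           lra.
        -- eapply left_graph_up_total with (n := n); eauto.
  - destruct (staircase (fun n => Nat.iter n g (-e)) x (h * x ^ 2 / 10)) as [n Hn].
    + assert (0 < x ^ 2) by (apply pow2_gt_0; assumption).
      assert (0 < h * x ^ 2) by (apply Rmult_lt_0_compat; lra). lra.
    + simpl. lra.
    + intros n H1 _.
      assert (H2 := iter_outer_nonpos _ _ _ _ _ _ n R Lg).
      assert (D := left_drift_nonpos _ _ _ _ _ _ (Nat.iter n g (-e)) R Lg).
      specialize (D ltac:(lra) ltac:(lra)). simpl Nat.iter.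
      set (t := Nat.iter n g (-e)) in *.
      assert (h * x ^ 2 <= h * t ^ 2) by (apply Rmult_le_compat_l; nra).
      lra.
    + eapply left_graph_outer_total; eauto.
Qed.

(** * Both half-lines *)

Record full_map (e h a : R) (g : R -> R) : Prop := {
  fm_zero : g 0 = 0;
  fm_diff : forall x y, -e <= x -> x <= y -> y <= e ->
    exists rho, Rabs rho <= 1 / 8 * Rmax (Rabs x) (Rabs y) /\
      g y - g x = (y - x) * (1 + h * (a + x + y + rho)) }.

(** Conjugation by [x |-> - x].  Reflection alone turns [x^2] into [- x^2], and so
    does inversion; the two together preserve the form of the map and change the
    sign of the parameter. *)
Definition mirror (f : R -> R) (x : R) : R := - f (- x).

Lemma mirror_opp : forall f x, mirror f (- x) = - f x.
Proof. intros f x. unfold mirror. now rewrite Ropp_involutive. Qed.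

Lemma iter_mirror : forall f n x, Nat.iter n (mirror f) x = - Nat.iter n f (- x).
Proof.
  intros f n x. induction n as [|n IH]; simpl; [ring|].
  rewrite IH. unfold mirror. now rewrite Ropp_involutive.
Qed.

Lemma full_map_slope : forall e h a g x y, ranges e h a a -> full_map e h a g ->
  -e <= x -> x <= y -> y <= e ->
  9 / 10 * (y - x) <= g y - g x <= 11 / 10 * (y - x).
Proof.
  intros e h a g x y R F Hx Hxy Hy.
  assert (Hb := ranges_bounds _ _ _ _ R). destruct R as [Hh He _ _].
  destruct (fm_diff _ _ _ _ F x y Hx Hxy Hy) as (rho & Hr & E).
  assert (Hr' : Rabs rho <= 1 / 8 * e).
  { eapply Rle_trans; [exact Hr|]. apply Rmult_le_compat_l; [lra|].
    apply Rmax_lub; apply Rabs_le; lra. }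
  apply Rabs_le_between in Hr'. rewrite E.
  set (q := a + x + y + rho). assert (Hq : -1/2 <= q <= 1/2) by (unfold q; lra).
  assert (H : -1/10 <= h * q <= 1/10) by nra.
  clearbody q. nra.
Qed.

Lemma full_map_at : forall e h a g x, full_map e h a g -> 0 <= x <= e ->
  exists rho, Rabs rho <= 1 / 8 * x /\ g x = x * (1 + h * (a + x + rho)).
Proof.
  intros e h a g x F Hx.
  destruct (fm_diff _ _ _ _ F 0 x) as (rho & Hr & E); try lra.
  rewrite Rabs_R0, (Rabs_pos_eq x), Rmax_right in Hr by lra.
  exists rho. split; [assumption|]. rewrite (fm_zero _ _ _ _ F) in E.
  replace (a + x + rho) with (a + 0 + x + rho) by ring. lra.
Qed.

Lemma full_map_edge : forall e h a g, ranges e h a a -> full_map e h a g -> e <= g e.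
Proof.
  intros e h a g R F.
  assert (Hb := ranges_bounds _ _ _ _ R). destruct R as [Hh He _ _].
  destruct (full_map_at _ _ _ _ e F) as (rho & Hr & E); [lra|].
  apply Rabs_le_between in Hr. rewrite E.
  assert (0 <= h * (a + e + rho)) by (apply Rmult_le_pos; lra). nra.
Qed.

Lemma full_map_inverse_r : forall e h a g y, ranges e h a a -> full_map e h a g ->
  g (-e) <= y <= g e -> -e <= inv_on e g y <= e /\ g (inv_on e g y) = y.
Proof.
  intros e h a g y R F Hy. unfold inv_on. apply epsilon_spec.
  assert (He := rg_e _ _ _ _ R).
  destruct (lipschitz_ivt g (-e) e (11 / 10) y) as (x & Hx & E); try lra.
  - intros u v Hu Huv Hv.
    assert (H := full_map_slope _ _ _ _ u v R F Hu Huv Hv). apply Rabs_le. lra.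
  - exists x. auto.
Qed.

Lemma full_map_injective : forall e h a g x y, ranges e h a a -> full_map e h a g ->
  -e <= x <= e -> -e <= y <= e -> g x = g y -> x = y.
Proof.
  intros e h a g x y R F Hx Hy E.
  destruct (Rle_dec x y) as [C|C].
  - assert (H := full_map_slope _ _ _ _ x y R F). lra.
  - assert (H := full_map_slope _ _ _ _ y x R F). lra.
Qed.

Lemma full_map_inverse_l : forall e h a g x, ranges e h a a -> full_map e h a g ->
  -e <= x <= e -> inv_on e g (g x) = x.
Proof.
  intros e h a g x R F Hx.
  assert (H1 := full_map_slope _ _ _ _ (-e) x R F).
  assert (H2 := full_map_slope _ _ _ _ x e R F).
  destruct (full_map_inverse_r _ _ _ _ (g x) R F) as [H3 H4]; [lra|].
  eapply full_map_injective; eauto.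
Qed.

Lemma full_map_inverse_pos : forall e h a g y, ranges e h a a -> full_map e h a g ->
  0 <= y <= e -> 0 <= inv_on e g y <= e /\ g (inv_on e g y) = y.
Proof.
  intros e h a g y R F Hy.
  assert (H1 := full_map_slope _ _ _ _ (-e) 0 R F). rewrite (fm_zero _ _ _ _ F) in H1.
  assert (H2 := full_map_edge _ _ _ _ R F).
  destruct (full_map_inverse_r _ _ _ _ y R F) as [H3 H4]; [lra|].
  assert (H5 := full_map_slope _ _ _ _ (inv_on e g y) 0 R F).
  rewrite (fm_zero _ _ _ _ F) in H5.
  split; [|assumption]. destruct (Rle_dec 0 (inv_on e g y)); lra.
Qed.

Lemma full_map_left : forall e h a g, ranges e h a a -> full_map e h a g ->
  left_map e h a g (inv_on e g).
Proof.
  intros e h a g R F. assert (He := rg_e _ _ _ _ R). split.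
  - apply (fm_zero _ _ _ _ F).
  - intros x y Hx Hxy Hy.
    destruct (fm_diff _ _ _ _ F x y) as (rho & Hr & E); try lra.
    exists rho. split; [|assumption].
    rewrite (Rabs_left1 x), (Rabs_left1 y), Rmax_left in Hr by lra. lra.
  - intros x Hx. eapply full_map_inverse_l; eauto. lra.
  - intros y Hy.
    assert (H1 := full_map_slope _ _ _ _ 0 e R F). rewrite (fm_zero _ _ _ _ F) in H1.
    destruct (full_map_inverse_r _ _ _ _ y R F) as [H3 H4]; [lra|].
    assert (H5 := full_map_slope _ _ _ _ 0 (inv_on e g y) R F).
    rewrite (fm_zero _ _ _ _ F) in H5.
    split; [|assumption]. destruct (Rle_dec (inv_on e g y) 0); lra.
Qed.

Lemma mirror_ranges : forall e h a, ranges e h a a -> ranges e h (- a) (- a / (1 + h * a)).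
Proof.
  intros e h a R.
  assert (Hb := ranges_bounds _ _ _ _ R). destruct R as [Hh He Ha _].
  split; try assumption.
  - now rewrite Rabs_Ropp.
  - assert (Hha : -1/100 <= h * a <= 1/100) by nra.
    replace (- a / (1 + h * a) - - a) with (a * ((h * a) / (1 + h * a))) by (field; lra).
    rewrite Rabs_mult, Rabs_Ropp. unfold Rdiv at 2.
    apply Rmult_le_compat_l; [apply Rabs_pos|].
    assert (Ha' : -1/199 <= h * a <= 1/199) by nra.
    apply Rabs_le. split; [apply Rle_div_r|apply Rle_div_l]; lra.
Qed.

(** With [u], [v] the preimages of two points, the left-hand side is the remainder in
    the difference quotient of the reflected inverse.  Its linear parts [u + v]
    cancel up to the factors [1 + O(h (a + u))], so the constant [1 / 8] grows only
    slightly. *)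
Lemma mirror_remainder_bound : forall e h a u v r ru rv,
  0 < h <= 1 / 5 -> 0 < e <= 1 / 25 -> - e / 2 <= a <= e / 2 ->
  0 <= v -> v <= u -> u <= e ->
  Rabs r <= 1 / 8 * u -> Rabs ru <= 1 / 8 * u -> Rabs rv <= 1 / 8 * v ->
  Rabs (u * (1 + h * (a + u + ru)) + v * (1 + h * (a + v + rv))
        - (u + v + r) / ((1 + h * (a + u + v + r)) * (1 + h * a)))
  <= 11 / 50 * (u * (1 + h * (a + u + ru))).
Proof.
  intros e h a u v r ru rv Hh He Ha Hv Hvu Hu Hr Hru Hrv.
  apply Rabs_le_between in Hr. apply Rabs_le_between in Hru. apply Rabs_le_between in Hrv.
  assert (P1 : -1/250 <= h * a <= 1/250) by nra.
  assert (P2 : -1/250 <= h * (a + u + v + r) <= 21/1000).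
  { assert (-1/50 <= a + u + v + r <= 21/200) by lra. nra. }
  assert (P3 : -1/250 <= h * (a + u + ru) <= 13/1000).
  { assert (-1/50 <= a + u + ru <= 13/200) by lra. nra. }
  assert (P4 : -1/250 <= h * (a + v + rv) <= 13/1000).
  { assert (-1/50 <= a + v + rv <= 13/200) by lra. nra. }
  set (d := (1 + h * (a + u + v + r)) * (1 + h * a)).
  assert (Hd : 992/1000 <= d <= 1026/1000).
  { unfold d. split.
    - apply Rle_trans with ((1 - 1/250) * (1 - 1/250)); [lra|].
      apply Rmult_le_compat; lra.
    - apply Rle_trans with ((1 + 21/1000) * (1 + 1/250)); [|lra].
      apply Rmult_le_compat; lra. }
  clearbody d.
  assert (Hq : 974/1000 * (u + v + r) <= (u + v + r) / d <= 1009/1000 * (u + v + r)).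
  { set (p := u + v + r). assert (Hp : 0 <= p) by (unfold p; lra).
    assert (p * (992/1000) <= p * d) by (apply Rmult_le_compat_l; lra).
    assert (p * d <= p * (1026/1000)) by (apply Rmult_le_compat_l; lra).
    split; [apply -> Rle_div_r|apply <- Rle_div_l]; lra. }
  set (q := (u + v + r) / d) in *. clearbody q.
  set (su := h * (a + u + ru)) in *. set (sv := h * (a + v + rv)) in *.
  assert (Q1 : - (1/250) * u <= u * su <= 13/1000 * u) by (clear - P3 Hvu Hv; nra).
  assert (Q2 : - (1/250) * v <= v * sv <= 13/1000 * v) by (clear - P4 Hvu Hv; nra).
  apply Rabs_le. lra.
Qed.

Lemma full_map_mirror : forall e h a g, ranges e h a a -> full_map e h a g ->
  left_map e h (- a / (1 + h * a)) (mirror (inv_on e g)) (mirror g).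
Proof.
  intros e h a g R F. assert (He := rg_e _ _ _ _ R). split.
  - unfold mirror. rewrite Ropp_0, <- (fm_zero _ _ _ _ F) at 1.
    rewrite (full_map_inverse_l _ _ _ _ _ R F); lra.
  - intros x y Hx Hxy Hy. unfold mirror.
    destruct (full_map_inverse_pos _ _ _ _ (- x) R F) as [Hu Eu]; [lra|].
    destruct (full_map_inverse_pos _ _ _ _ (- y) R F) as [Hv Ev]; [lra|].
    set (u := inv_on e g (- x)) in *. set (v := inv_on e g (- y)) in *.
    clearbody u v.
    assert (Hvu : v <= u).
    { assert (H := full_map_slope _ _ _ _ u v R F).
      destruct (Rle_dec v u); lra. }
    destruct (fm_diff _ _ _ _ F v u) as (r & Hr & E); try lra.
    destruct (full_map_at _ _ _ _ u F) as (ru & Hru & Eu'); try lra.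
    destruct (full_map_at _ _ _ _ v F) as (rv & Hrv & Ev'); try lra.
    rewrite (Rabs_pos_eq u), (Rabs_pos_eq v), Rmax_right in Hr by lra.
    assert (Ha := rg_a _ _ _ _ R). assert (Hh := rg_h _ _ _ _ R).
    assert (Ha' : - e / 2 <= a <= e / 2)
      by (assert (H := Rabs_le_between a (Rabs a)); lra).
    assert (K := mirror_remainder_bound e h a u v r ru rv Hh He Ha'
      (proj1 Hv) Hvu (proj2 Hu) Hr Hru Hrv).
    rewrite <- Eu', <- Ev', Eu, Ev in K.
    eexists. split; [exact K|].
    apply Rabs_le_between in Hr.
    assert (P1 : 0 < 1 + h * a) by nra.
    assert (P2 : 0 < 1 + h * (a + v + u + r)).
    { assert (-1/2 <= a + v + u + r) by lra. nra. }
    replace (y - x) with ((u - v) * (1 + h * (a + v + u + r))) by lra.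
    field. split; [lra|]. replace (a + u + v + r) with (a + v + u + r) by ring. lra.
  - intros x Hx. unfold mirror. rewrite Ropp_involutive.
    destruct (full_map_inverse_pos _ _ _ _ (- x) R F) as [_ E]; lra.
  - intros y Hy. unfold mirror in *. rewrite !Ropp_involutive in Hy.
    destruct (full_map_inverse_pos _ _ _ _ e R F) as [Hu Eu]; [lra|].
    assert (H1 := full_map_slope _ _ _ _ 0 (- y) R F). rewrite (fm_zero _ _ _ _ F) in H1.
    assert (H2 := full_map_slope _ _ _ _ (- y) (inv_on e g e) R F).
    rewrite !Ropp_involutive, (full_map_inverse_l _ _ _ _ _ R F); lra.
Qed.

(** If [g u = G v] then [G v - G u = g u - G u], so the inverses are as close as the
    maps; the factor [2] absorbs the difference between a point and its preimage. *)
Lemma mirror_close : forall e h a B g G, ranges e h a a ->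
  full_map e h a g -> full_map e h a G -> 0 <= B ->
  (forall x, -e <= x <= e -> Rabs (G x - g x) <= B * h * Rabs x ^ 3) ->
  left_close e h (2 * B) (mirror (inv_on e g)) (mirror (inv_on e G)).
Proof.
  intros e h a B g G R Fg FG HB HC x Hx. unfold mirror.
  assert (He := rg_e _ _ _ _ R). assert (Hh := rg_h _ _ _ _ R).
  set (X := - x) in *. assert (HX : 0 <= X <= e) by (unfold X; lra). clearbody X.
  destruct (full_map_inverse_pos _ _ _ _ X R Fg) as [Hu Eu]; [lra|].
  destruct (full_map_inverse_pos _ _ _ _ X R FG) as [Hv Ev]; [lra|].
  set (u := inv_on e g X) in *. set (v := inv_on e G X) in *. clearbody u v.
  specialize (HC u ltac:(lra)). rewrite (Rabs_pos_eq u) in HC by lra.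
  assert (S0 := full_map_slope _ _ _ _ 0 u R Fg). rewrite (fm_zero _ _ _ _ Fg) in S0.
  assert (S1 : 9 / 10 * Rabs (- v - - u) <= Rabs (G u - g u)).
  { destruct (Rle_dec u v) as [C|C].
    - assert (S1 := full_map_slope _ _ _ _ u v R FG).
      rewrite (Rabs_left1 (- v - - u)), (Rabs_left1 (G u - g u)) by lra. lra.
    - assert (S1 := full_map_slope _ _ _ _ v u R FG).
      rewrite (Rabs_pos_eq (- v - - u)), (Rabs_pos_eq (G u - g u)) by lra. lra. }
  assert (S2 : u ^ 3 <= (10 / 9 * X) ^ 3) by (apply pow_incr; lra).
  assert (S3 : 0 <= B * h * X ^ 3).
  { apply Rmult_le_pos; [apply Rmult_le_pos; lra|apply pow_le; lra]. }
  assert (S4 : B * h * u ^ 3 <= B * h * (10 / 9 * X) ^ 3)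
    by (apply Rmult_le_compat_l; [apply Rmult_le_pos; lra|assumption]).
  replace (B * h * (10 / 9 * X) ^ 3) with (1000 / 729 * (B * h * X ^ 3)) in S4 by field.
  lra.
Qed.

Record full_pair (e h a B : R) (g G : R -> R) : Prop := {
  fp_ranges : ranges e h a a;
  fp_g : full_map e h a g;
  fp_G : full_map e h a G;
  fp_B : 0 <= B;
  fp_close : forall x, -e <= x <= e -> Rabs (G x - g x) <= B * h * Rabs x ^ 3 }.

Lemma full_pair_left : forall e h a B g G, full_pair e h a B g G ->
  left_pair e h a a (2 * B) g (inv_on e g) G (inv_on e G).
Proof.
  intros e h a B g G [R Fg FG HB HC]. split.
  - exact R.
  - apply full_map_left; assumption.
  - apply full_map_left; assumption.
  - lra.
  - intros x Hx. specialize (HC x). rewrite (Rabs_left1 x) in HC by lra.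
    specialize (HC ltac:(lra)).
    assert (0 <= B * h * (- x) ^ 3); [|lra].
    apply Rmult_le_pos; [|apply pow_le; lra].
    apply Rmult_le_pos; [lra|]. apply Rlt_le, (rg_h _ _ _ _ R).
Qed.

Lemma full_pair_mirror : forall e h a B g G, full_pair e h a B g G ->
  left_pair e h (- a) (- a / (1 + h * a)) (2 * B)
    (mirror (inv_on e g)) (mirror g) (mirror (inv_on e G)) (mirror G).
Proof.
  intros e h a B g G [R Fg FG HB HC]. split.
  - apply mirror_ranges; assumption.
  - apply full_map_mirror; assumption.
  - apply full_map_mirror; assumption.
  - lra.
  - eapply mirror_close; eauto.
Qed.

Lemma left_graph_conj : forall e a g G x y,
  left_graph g (inv_on e g) G (inv_on e G) e a x y -> conj_graph g G e a x y.
Proof.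
  intros e a g G x y H.
  induction H as [|w W Ha [Fw Ew] [FW EW]|x Ha Hx|n x y Ha Hn Hx _ IH|n x y Ha Hx _ IH|x Hx
    |n x y Hn Hx _ IH].
  - apply cg_zero.
  - apply cg_neg_fix; assumption.
  - apply cg_neg_in_base; assumption.
  - eapply cg_neg_in_down; eauto.
  - eapply cg_neg_in_up; eauto.
  - apply cg_neg_out_base; assumption.
  - eapply cg_neg_out_up; eauto.
Qed.

Lemma affine_mirror : forall u u' v v' x, u <> v ->
  - affine u u' v v' x = affine (- v) (- v') (- u) (- u') (- x).
Proof. intros u u' v v' x H. unfold affine. field. lra. Qed.

Lemma mirror_iter_bounds : forall f m n s x,
  Nat.iter n f s <= x <= Nat.iter m f s <->
  Nat.iter m (mirror f) (- s) <= - x <= Nat.iter n (mirror f) (- s).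
Proof. intros f m n s x. rewrite !iter_mirror, Ropp_involutive. lra. Qed.

Lemma mirror_fixpoint : forall e h a g w, ranges e h a a -> full_map e h a g ->
  left_fixpoint e (mirror (inv_on e g)) (- w) <-> 0 < w <= e /\ g w = w.
Proof.
  intros e h a g w R F. unfold left_fixpoint, mirror. rewrite Ropp_involutive.
  split; intros [Hw E]; (split; [lra|]).
  - destruct (full_map_inverse_pos _ _ _ _ w R F) as [_ E']; [lra|].
    replace (inv_on e g w) with w in E' by lra. exact E'.
  - rewrite <- E at 1. rewrite (full_map_inverse_l _ _ _ _ _ R F); lra.
Qed.

Lemma down_negative : forall e h a b g gi n x, ranges e h a b -> left_map e h b g gi ->
  0 < a -> Nat.iter (S n) g (- a / 3) <= x <= Nat.iter n g (- a / 3) -> x < 0 /\ gi x < 0.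
Proof.
  intros e h a b g gi n x R L Ha Hx.
  destruct (left_fixpoint_exists _ _ _ _ _ _ R L Ha) as [w F].
  assert (H1 := iter_inner_down _ _ _ _ _ _ _ n R L Ha F).
  assert (H2 := iter_inner_down _ _ _ _ _ _ _ (S n) R L Ha F).
  destruct (left_inner_backward _ _ _ _ _ _ w x R L F); lra.
Qed.

Lemma up_negative : forall e h a b g gi n x, ranges e h a b -> left_map e h b g gi ->
  0 < a -> Nat.iter n gi (- a / 3) <= x <= Nat.iter (S n) gi (- a / 3) -> x < 0 /\ g x < 0.
Proof.
  intros e h a b g gi n x R L Ha Hx.
  destruct (left_fixpoint_exists _ _ _ _ _ _ R L Ha) as [w F].
  assert (O := left_fixpoint_order _ _ _ _ _ _ _ R L Ha F).
  assert (H1 := iter_inner_up _ _ _ _ _ _ _ n R L Ha F).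
  assert (H2 := iter_inner_up _ _ _ _ _ _ _ (S n) R L Ha F).
  assert (H3 := left_map_range _ _ _ _ _ _ x R L). lra.
Qed.

Lemma outer_negative : forall e h a b g gi n x, ranges e h a b -> left_map e h b g gi ->
  (1 <= n)%nat -> Nat.iter n g (- e) <= x <= Nat.iter (S n) g (- e) -> x < 0 /\ gi x < 0.
Proof.
  intros e h a b g gi n x R L Hn Hx. destruct n as [|n]; [lia|].
  assert (H1 := iter_outer_nonpos _ _ _ _ _ _ n R L).
  assert (H2 := iter_outer_nonpos _ _ _ _ _ _ (S (S n)) R L).
  assert (H3 := left_map_nondecreasing _ _ _ _ _ _ (-e) (Nat.iter n g (- e)) R L).
  simpl in Hx, H2.
  destruct (left_inverse _ _ _ _ _ _ x R L); lra.
Qed.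

Lemma mirror_graph_conj : forall e h a B g G x y, full_pair e h a B g G ->
  left_graph (mirror (inv_on e g)) (mirror g) (mirror (inv_on e G)) (mirror G) e (- a) x y ->
  conj_graph g G e a (- x) (- y).
Proof.
  intros e h a B g G x y P H.
  destruct (full_pair_mirror _ _ _ _ _ _ P) as [R Lg LG _ _].
  destruct P as [R' Fg FG _ _].
  assert (E : - - a / 3 = - (- a / 3)) by field.
  induction H as [|w W Ha Fw FW|x Ha Hx|n x y Ha Hn Hx _ IH|n x y Ha Hx _ IH|x Hx
    |n x y Hn Hx _ IH].
  - rewrite Ropp_0. apply cg_zero.
  - rewrite <- (Ropp_involutive w), <- (Ropp_involutive W) in *.
    apply (mirror_fixpoint _ _ _ _ _ R' Fg) in Fw.
    apply (mirror_fixpoint _ _ _ _ _ R' FG) in FW.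
    rewrite !Ropp_involutive in *.
    apply cg_pos_fix; tauto || lra.
  - destruct (left_fixpoint_exists _ _ _ _ _ _ R Lg Ha) as [w Fw].
    assert (O := left_fixpoint_order _ _ _ _ _ _ _ R Lg Ha Fw).
    rewrite affine_mirror by lra.
    rewrite E in *. unfold mirror in *. rewrite !Ropp_involutive in *.
    apply cg_pos_in_base; lra.
  - rewrite E, <- (Ropp_involutive x) in Hx. apply mirror_iter_bounds in Hx.
    unfold mirror in *. rewrite Ropp_involutive in *.
    eapply cg_pos_in_up; eauto. lra.
  - rewrite E, <- (Ropp_involutive x) in Hx. apply mirror_iter_bounds in Hx.
    unfold mirror in *. rewrite Ropp_involutive in *.
    eapply cg_pos_in_down; eauto. lra.
  - assert (O := left_map_edge _ _ _ _ _ _ R Lg).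
    rewrite affine_mirror by lra.
    unfold mirror in *. rewrite !Ropp_involutive in *.
    apply cg_pos_out_base; lra.
  - rewrite <- (Ropp_involutive x) in Hx. apply mirror_iter_bounds in Hx.
    unfold mirror in *. rewrite Ropp_involutive in *.
    eapply cg_pos_out_down; eauto.
Qed.

(** The recursions over [x < 0] never leave the negative half-line and those over
    [x > 0] never leave the positive one, so a derivation stays in one half. *)
Lemma conj_graph_split : forall e h a B g G x y, full_pair e h a B g G ->
  conj_graph g G e a x y ->
  (x <= 0 /\ left_graph g (inv_on e g) G (inv_on e G) e a x y) \/
  (0 <= x /\ left_graph (mirror (inv_on e g)) (mirror g) (mirror (inv_on e G)) (mirror G)
               e (- a) (- x) (- y)).
Proof.
  intros e h a B g G x y P H.
  destruct (full_pair_left _ _ _ _ _ _ P) as [R1 Lg1 LG1 _ _].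
  destruct (full_pair_mirror _ _ _ _ _ _ P) as [R2 Lg2 LG2 _ _].
  destruct P as [R' Fg FG _ _].
  assert (He := rg_e _ _ _ _ R').
  assert (E : - - a / 3 = - (- a / 3)) by field.
  induction H as [|w W Ha Hw Ew HW EW|x Ha x0 Hx|n x y Ha Hn x0 Hx _ IH|n x y Ha x0 Hx _ IH
    |x z0 Hx|n x y Hn z0 Hx _ IH|w W Ha Hw Ew HW EW|x Ha x0 Hx|n x y Ha Hn x0 Hx _ IH
    |n x y Ha x0 Hx _ IH|x z0 Hx|n x y Hn z0 Hx _ IH]; try subst x0; try subst z0.
  - left. split; [lra|apply lg_zero].
  - left. split; [lra|]. apply lg_fix; [assumption|split; assumption..].
  - left. split; [lra|]. apply lg_in_base; assumption.
  - destruct (down_negative _ _ _ _ _ _ _ _ R1 Lg1 Ha Hx) as [H1 H2].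
    left. split; [lra|]. destruct IH as [[_ IH]|[H3 _]]; [|lra].
    eapply lg_in_down; eauto.
  - destruct (up_negative _ _ _ _ _ _ _ _ R1 Lg1 Ha Hx) as [H1 H2].
    left. split; [lra|]. destruct IH as [[_ IH]|[H3 _]]; [|lra].
    eapply lg_in_up; eauto.
  - left. split; [|apply lg_out_base; assumption].
    assert (H1 := left_map_range _ _ _ _ _ _ (-e) R1 Lg1). lra.
  - destruct (outer_negative _ _ _ _ _ _ _ _ R1 Lg1 Hn Hx) as [H1 H2].
    left. split; [lra|]. destruct IH as [[_ IH]|[H3 _]]; [|lra].
    eapply lg_out_up; eauto.
  - right. split; [lra|]. apply lg_fix; [lra| |].
    + apply (mirror_fixpoint _ _ _ _ _ R' Fg); auto.
    + apply (mirror_fixpoint _ _ _ _ _ R' FG); auto.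
  - right. assert (Ha' : 0 < - a) by lra.
    split; [lra|].
    destruct (left_fixpoint_exists _ _ _ _ _ _ R2 Lg2 Ha') as [w Fw].
    assert (O := left_fixpoint_order _ _ _ _ _ _ _ R2 Lg2 Ha' Fw).
    assert (H := lg_in_base (mirror (inv_on e g)) (mirror g) (mirror (inv_on e G))
      (mirror G) e (- a) (- x) Ha').
    rewrite E, !mirror_opp in H. rewrite E, !mirror_opp in O.
    rewrite affine_mirror by lra. apply H. lra.
  - apply mirror_iter_bounds in Hx. rewrite <- E in Hx.
    assert (Ha' : 0 < - a) by lra.
    destruct (down_negative _ _ _ _ _ _ _ _ R2 Lg2 Ha' Hx) as [H1 H2].
    rewrite mirror_opp in H2.
    right. split; [lra|]. destruct IH as [[H3 _]|[_ IH]]; [lra|].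
    rewrite <- (mirror_opp (inv_on e G)).
    eapply lg_in_down; [assumption|exact Hn|exact Hx|]. rewrite mirror_opp. exact IH.
  - apply mirror_iter_bounds in Hx. rewrite <- E in Hx.
    assert (Ha' : 0 < - a) by lra.
    destruct (up_negative _ _ _ _ _ _ _ _ R2 Lg2 Ha' Hx) as [H1 H2].
    rewrite mirror_opp in H2.
    right. split; [lra|]. destruct IH as [[H3 _]|[_ IH]]; [lra|].
    rewrite <- (mirror_opp G).
    eapply lg_in_up; [assumption|exact Hx|]. rewrite mirror_opp. exact IH.
  - right.
    assert (H1 := left_map_range _ _ _ _ _ _ (-e) R2 Lg2 ltac:(lra)).
    rewrite mirror_opp in H1. split; [lra|].
    assert (H := lg_out_base (mirror (inv_on e g)) (mirror g) (mirror (inv_on e G))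
      (mirror G) e (- a) (- x)).
    rewrite !mirror_opp in H.
    rewrite affine_mirror by lra. apply H. lra.
  - apply mirror_iter_bounds in Hx.
    destruct (outer_negative _ _ _ _ _ _ _ _ R2 Lg2 Hn Hx) as [H1 H2].
    rewrite mirror_opp in H2.
    right. split; [lra|]. destruct IH as [[H3 _]|[_ IH]]; [lra|].
    rewrite <- (mirror_opp (inv_on e G)).
    eapply lg_out_up; [exact Hn|exact Hx|]. rewrite mirror_opp. exact IH.
Qed.

Lemma conj_graph_close : forall e h a B g G x y, full_pair e h a B g G ->
  conj_graph g G e a x y -> Rabs (x - y) <= 40 * B.
Proof.
  intros e h a B g G x y P H.
  destruct (conj_graph_split _ _ _ _ _ _ _ _ P H) as [[_ H']|[_ H']].
  - assert (K := left_graph_close _ _ _ _ _ _ _ _ _ _ _ (full_pair_left _ _ _ _ _ _ P) H').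
    lra.
  - assert (K := left_graph_close _ _ _ _ _ _ _ _ _ _ _ (full_pair_mirror _ _ _ _ _ _ P) H').
    replace (x - y) with (- (- x - - y)) by ring. rewrite Rabs_Ropp. lra.
Qed.

Lemma conj_graph_total : forall e h a B g G x, full_pair e h a B g G -> Rabs x <= e ->
  exists y, conj_graph g G e a x y.
Proof.
  intros e h a B g G x P Hx. apply Rabs_le_between in Hx.
  destruct (Rle_dec x 0) as [C|C].
  - destruct (left_graph_total _ _ _ _ _ _ _ _ _ x (full_pair_left _ _ _ _ _ _ P))
      as [y Hy]; [lra|].
    exists y. apply left_graph_conj. exact Hy.
  - destruct (left_graph_total _ _ _ _ _ _ _ _ _ (- x) (full_pair_mirror _ _ _ _ _ _ P))
      as [y Hy]; [lra|].
    exists (- y). rewrite <- (Ropp_involutive x).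
    eapply mirror_graph_conj; eauto.
Qed.

Lemma conjJ_graph : forall e h a B NPhi Nphi x,
  full_pair e h a B (fun t => Nphi h t a) (fun t => NPhi h t a) -> Rabs x <= e ->
  conj_graph (fun t => Nphi h t a) (fun t => NPhi h t a) e a x (conjJ NPhi Nphi e h x a).
Proof.
  intros e h a B NPhi Nphi x P Hx. unfold conjJ. apply epsilon_spec.
  eapply conj_graph_total; eauto.
Qed.

(** * Normal forms *)

(** The remainder is the difference quotient of [x^3 eta], whose derivative is at most
    [3 K M^2 + K M^3] on [[- M, M]]; since [K e0 <= 1 / 25], this is less than
    [M / 8]. *)
Lemma normal_form_full_map : forall k h0 e0 a0 K N eta h a, (1 <= k)%nat -> 0 < K ->
  admissible_box K h0 e0 a0 -> normal_form k h0 e0 a0 K N eta ->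
  0 < h <= h0 -> Rabs a <= a0 ->
  full_map e0 h a (fun t => N h t a).
Proof.
  intros k h0 e0 a0 K N eta h a Hk HK (Hh0 & He0 & Ha0 & Hae) [Hs Hb HN] Hh Ha.
  assert (Hbox : forall x, -e0 <= x <= e0 -> box h0 e0 a0 (h, x, a)).
  { intros x Hx. split; [simpl; lra|]. split; simpl; [apply Rabs_le; lra|lra]. }
  assert (He1 : e0 <= 1 / 25) by (eapply Rle_trans; [apply He0|apply Rmin_l]).
  assert (HKe : K * e0 <= 1 / 25).
  { assert (H : e0 <= 1 / (25 * K)) by (eapply Rle_trans; [apply He0|apply Rmin_r]).
    apply (Rmult_le_compat_l K) in H; [|lra].
    replace (K * (1 / (25 * K))) with (1 / 25) in H by (field; lra). exact H. }
  set (u := fun t => eta h t a).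
  assert (Hu : forall x, -e0 <= x <= e0 -> is_derive u x (Derive u x)).
  { intros x Hx. apply Derive_correct.
    destruct Hs as (U & _ & HU & HC). destruct k as [|k]; [lia|].
    destruct HC as [_ [HC _]]. apply (HC h x a). apply HU, Hbox, Hx. }
  assert (Hub : forall x, -e0 <= x <= e0 -> Rabs (u x) <= K /\ Rabs (Derive u x) <= K).
  { intros x Hx. destruct (Hb h x a (Hbox x Hx)) as (H1 & H2 & _). split; assumption. }
  pose (r := fun t => t ^ 3 * u t).
  assert (Hr : forall x y, -e0 <= x -> x <= y -> y <= e0 ->
    Rabs (r y - r x) <= 1 / 8 * Rmax (Rabs x) (Rabs y) * (y - x)).
  { intros x y Hx Hxy Hy.
    destruct (MVT_gen r x y (fun t => 3 * t ^ 2 * u t + t ^ 3 * Derive u t)) as (c & Hc & E).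
    - intros t Ht. rewrite Rmin_left, Rmax_right in Ht by lra.
      unfold r. evar_last.
      + apply @is_derive_mult; [|apply Hu; lra|intros; apply Rmult_comm].
        apply is_derive_pow, is_derive_id.
      + unfold plus, mult, one; simpl. ring.
    - intros t Ht. rewrite Rmin_left, Rmax_right in Ht by lra.
      apply continuity_pt_filterlim. apply (@continuous_mult R_UniformSpace).
      + apply (ex_derive_continuous (fun t => t ^ 3)). auto_derive. exact I.
      + apply (ex_derive_continuous u). eexists. apply Hu. lra.
    - rewrite Rmin_left, Rmax_right in Hc by lra.
      rewrite E, Rabs_mult, (Rabs_pos_eq (y - x)) by lra.
      apply Rmult_le_compat_r; [lra|].
      destruct (Hub c) as [H1 H2]; [lra|].
      set (M := Rmax (Rabs x) (Rabs y)).
      assert (HM : Rabs c <= M).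
      { unfold M, Rmax, Rabs. repeat destruct Rcase_abs; destruct Rle_dec; lra. }
      assert (HMe : M <= e0) by (apply Rmax_lub; apply Rabs_le; lra).
      assert (H0 := Rabs_pos c).
      eapply Rle_trans; [apply Rabs_triang|].
      rewrite !Rabs_mult, <- !RPow_abs, (Rabs_pos_eq 3) by lra.
      assert (HKM : K * M <= 1 / 25).
      { eapply Rle_trans; [|exact HKe]. apply Rmult_le_compat_l; lra. }
      apply Rle_trans with (3 * M ^ 2 * K + M ^ 3 * K).
      + assert (C : forall n, 0 <= Rabs c ^ n <= M ^ n)
          by (intros n; split; [apply pow_le|apply pow_incr]; lra).
        assert (C2 := C 2%nat). assert (C3 := C 3%nat).
        apply Rplus_le_compat; apply Rmult_le_compat; try apply Rabs_pos; lra.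
      + replace (3 * M ^ 2 * K + M ^ 3 * K) with ((K * M) * (M * (3 + M))) by ring.
        apply Rle_trans with (1 / 25 * (M * (3 + M))).
        * apply Rmult_le_compat_r; [apply Rmult_le_pos; lra|lra].
        * assert (M * M <= M * (1 / 25)) by (apply Rmult_le_compat_l; lra). lra. }
  assert (HN' : forall x, -e0 <= x <= e0 -> N h x a = (1 + h * a) * x + h * x ^ 2 + h * r x).
  { intros x Hx. rewrite (HN h x a (Hbox x Hx)). unfold r, u. ring. }
  split.
  - rewrite HN' by lra. unfold r. ring.
  - intros x y Hx Hxy Hy. specialize (Hr x y Hx Hxy Hy).
    rewrite !HN' by lra.
    destruct (Req_dec x y) as [->|Hne].
    + exists 0. split; [|ring]. rewrite Rabs_R0.
      apply Rmult_le_pos; [lra|]. eapply Rle_trans; [apply Rabs_pos|apply Rmax_l].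
    + exists ((r y - r x) / (y - x)). split.
      * unfold Rdiv at 1. rewrite Rabs_mult, Rabs_inv, (Rabs_pos_eq (y - x)) by lra.
        apply Rle_div_l; lra.
      * field. lra.
Qed.

Lemma normal_form_full_pair : forall p k h0 e0 a0 K c NPhi Nphi eta eta' h a,
  (1 <= k)%nat -> normal_form_pair p k h0 e0 a0 K c NPhi Nphi eta eta' ->
  0 < h <= h0 -> Rabs a <= a0 ->
  full_pair e0 h a (c * h ^ p) (fun t => Nphi h t a) (fun t => NPhi h t a).
Proof.
  intros p k h0 e0 a0 K c NPhi Nphi eta eta' h a Hk [HK Hc Hbox HP Hp HC] Hh Ha.
  split.
  - destruct Hbox as (H1 & H2 & H3 & H4).
    assert (e0 <= 1 / 25) by (eapply Rle_trans; [apply H2|apply Rmin_l]).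
    split; try lra. rewrite Rminus_diag, Rabs_R0. assert (H5 := Rabs_pos a). lra.
  - apply (normal_form_full_map k h0 e0 a0 K _ eta'); assumption.
  - apply (normal_form_full_map k h0 e0 a0 K _ eta); assumption.
  - apply Rmult_le_pos; [lra|apply pow_le; lra].
  - intros x Hx. eapply Rle_trans; [apply HC; try lra; apply Rabs_le; lra|].
    rewrite pow_add, pow_1. right. ring.
Qed.

Lemma conjugacy_estimate : forall p k h0 e0 a0 K c NPhi Nphi eta eta',
  (1 <= k)%nat -> normal_form_pair p k h0 e0 a0 K c NPhi Nphi eta eta' ->
  forall h x a, 0 < h <= h0 -> Rabs x <= e0 -> Rabs a <= a0 ->
    Rabs (x - conjJ NPhi Nphi e0 h x a) <= 40 * c * h ^ p.
Proof.
  intros p k h0 e0 a0 K c NPhi Nphi eta eta' Hk HN h x a Hh Hx Ha.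
  assert (P := normal_form_full_pair _ _ _ _ _ _ _ _ _ _ _ h a Hk HN Hh Ha).
  rewrite Rmult_assoc. eapply conj_graph_close; [exact P|].
  eapply conjJ_graph; eauto.
Qed.

(** * Optimality *)

Lemma Ck_pow : forall k (U : R * R * R -> Prop) (c : R) (n : nat),
  Ck k U (fun h _ _ => c * h ^ n).
Proof.
  intros k U.
  assert (Hc : forall (c : R) (n : nat) (q : R * R * R),
    continuous (fun q : R * R * R => c * fst (fst q) ^ n) q).
  { intros c n q.
    apply (continuous_comp (fun q : R * R * R => fst (fst q)) (fun t => c * t ^ n)).
    - apply (continuous_comp fst fst); apply continuous_fst.
    - apply (ex_derive_continuous (fun t => c * t ^ n)). auto_derive. exact I. }
  induction k as [|k IH]; intros c n.
  - split; [intros q _; apply Hc|exact I].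
  - split; [intros q _; apply Hc|]. split; [|split; [|split]].
    + intros h x a _. repeat split; auto_derive; exact I.
    + replace (fun h x a : R => Derive (fun t => c * t ^ n) h)
        with (fun h (_ _ : R) => (c * INR n) * h ^ (pred n)); [apply IH|].
      extensionality h. extensionality x. extensionality a.
      symmetry. apply is_derive_unique. auto_derive; [exact I|ring].
    + replace (fun h x a : R => Derive (fun t => c * h ^ n) x)
        with (fun h (_ _ : R) => 0 * h ^ 0); [apply IH|].
      extensionality h. extensionality x. extensionality a.
      rewrite Derive_const. ring.
    + replace (fun h x a : R => Derive (fun t => c * h ^ n) a)
        with (fun h (_ _ : R) => 0 * h ^ 0); [apply IH|].
      extensionality h. extensionality x. extensionality a.
      rewrite Derive_const. ring.
Qed.

(** [c = 0] gives a map with fixed point exactly [- a], and [c = 1] a perturbation of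
    it of the largest size allowed. *)
Definition cubic_model (c : R) (n : nat) (h x a : R) : R :=
  (1 + h * a) * x + h * x ^ 2 + h * x ^ 3 * (c * h ^ n).

Lemma cubic_model_normal_form : forall k n c e0 a0, 0 <= c <= 1 ->
  normal_form k (1 / 5) e0 a0 1 (cubic_model c n) (fun h _ _ => c * h ^ n).
Proof.
  intros k n c e0 a0 Hc. split.
  - exists (fun _ => True). split; [apply open_true|]. split; [auto|apply Ck_pow].
  - intros h x a [Hh _]. simpl in Hh.
    rewrite !Derive_const, (Derive_n_const 1), Rabs_R0.
    split; [|lra].
    assert (0 <= h ^ n <= 1).
    { split; [apply pow_le; lra|]. rewrite <- (pow1 n). apply pow_incr; lra. }
    rewrite Rabs_pos_eq; nra.
  - reflexivity.
Qed.

Lemma eps_of_1 : eps_of 1 = 1 / 25.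
Proof. unfold eps_of. rewrite Rmult_1_r. apply Rmin_left. lra. Qed.

Lemma alp_of_1 : alp_of 1 = 1 / 51.
Proof. unfold alp_of. rewrite Rmult_1_r. apply Rmin_left. lra. Qed.

Lemma cubic_model_pair : forall p k,
  normal_form_pair p k (1 / 5) (eps_of 1) (alp_of 1) 1 1
    (cubic_model 0 p) (cubic_model 1 p) (fun h _ _ => 0 * h ^ p) (fun h _ _ => 1 * h ^ p).
Proof.
  intros p k. split; try lra.
  - unfold admissible_box. rewrite eps_of_1, alp_of_1. lra.
  - apply cubic_model_normal_form. lra.
  - apply cubic_model_normal_form. lra.
  - intros h x a Hh _ _. unfold cubic_model.
    replace (_ - _) with (- (h ^ (p + 1) * x ^ 3)) by (rewrite pow_add; ring).
    rewrite Rabs_Ropp, Rabs_mult, RPow_abs, (Rabs_pos_eq (h ^ (p + 1)))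
      by (apply pow_le; lra). lra.
Qed.

(** A conjugacy must send the fixed point [w] of one map to the fixed point [- a] of
    the other, and [w + a = - h^p w^2]. *)
Lemma cubic_model_displacement : forall p h a, 0 < h <= 1 / 5 -> 0 < a <= alp_of 1 ->
  exists w, Rabs w <= eps_of 1 /\
    a ^ 2 / 2 * h ^ p <=
      Rabs (w - conjJ (cubic_model 0 p) (cubic_model 1 p) (eps_of 1) h w a).
Proof.
  intros p h a Hh Ha.
  assert (P := normal_form_full_pair _ _ _ _ _ _ _ _ _ _ _ h a (le_n 1)
    (cubic_model_pair p 1) Hh ltac:(rewrite Rabs_pos_eq; lra)).
  assert (PL := full_pair_left _ _ _ _ _ _ P).
  assert (R := lp_ranges _ _ _ _ _ _ _ _ _ PL).
  assert (Lg := lp_g _ _ _ _ _ _ _ _ _ PL). assert (LG := lp_G _ _ _ _ _ _ _ _ _ PL).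
  destruct (left_fixpoint_exists _ _ _ _ _ _ R Lg (proj1 Ha)) as [w Fw].
  destruct (left_fixpoint_exists _ _ _ _ _ _ R LG (proj1 Ha)) as [W FW].
  assert (Bw := left_fixpoint_bounds _ _ _ _ _ _ _ R Lg Fw).
  exists w. assert (Hw := proj1 Fw).
  assert (Hwe : Rabs w <= eps_of 1) by (apply Rabs_le; lra).
  split; [exact Hwe|].
  assert (HJ := conjJ_graph _ _ _ _ _ _ _ P Hwe).
  destruct (conj_graph_split _ _ _ _ _ _ _ _ P HJ) as [[_ HJ']|[H _]]; [|lra].
  rewrite (io_fix _ _ _ _ _ _ _ _ _
    (left_graph_pos_close _ _ _ _ _ _ _ _ _ _ _ _ _ PL (proj1 Ha) Fw FW HJ') eq_refl).
  assert (EW : W = - a).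
  { destruct FW as [HW E]. unfold cubic_model in E.
    assert (H : h * - W * (a + W) = 0) by lra.
    apply Rmult_integral in H. destruct H as [H|H]; [|lra].
    apply Rmult_integral in H. lra. }
  assert (Ew : a + w + h ^ p * w ^ 2 = 0).
  { destruct Fw as [_ E]. unfold cubic_model in E.
    assert (H : h * w * (a + w + h ^ p * w ^ 2) = 0) by lra.
    apply Rmult_integral in H. destruct H as [H|H]; [|lra].
    apply Rmult_integral in H. lra. }
  rewrite EW. replace (w - - a) with (- (h ^ p * w ^ 2)) by lra.
  assert (Hp : 0 <= h ^ p) by (apply pow_le; lra).
  rewrite Rabs_Ropp, Rabs_pos_eq by (apply Rmult_le_pos; [lra|apply pow2_ge_0]).
  rewrite Rmult_comm. apply Rmult_le_compat_l; [lra|]. nra.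
Qed.

Theorem theorem2p6 : forall p : nat, (1 <= p)%nat ->
  (forall (f : R -> R -> R) (Phi phi : R -> R -> R -> R) (d : R),
     0 < d ->
     Ck (p + 6) (fun _ => True) (fun _ x a => f x a) ->
     transcritical d f ->
     time_map d f Phi ->
     discretization d p Phi phi ->
     forall (k : nat) (h0 e0 a0 K c : R) (NPhi Nphi eta eta' : R -> R -> R -> R),
     (2 <= k)%nat ->
     normal_form_pair p k h0 e0 a0 K c NPhi Nphi eta eta' ->
     normal_forms_of p k d h0 e0 a0 Phi phi NPhi Nphi ->
     exists const : R, 0 < const /\
       forall h x alpha, 0 < h <= h0 -> Rabs x <= e0 -> Rabs alpha <= a0 ->
         Rabs (x - conjJ NPhi Nphi e0 h x alpha) <= const * h ^ p)
  /\
  (exists (K c : R) (NPhi Nphi eta eta' : R -> R -> R -> R),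
     (forall k : nat,
        normal_form_pair p k (1 / 5) (eps_of K) (alp_of K) K c NPhi Nphi eta eta') /\
     exists a1 : R, 0 < a1 <= alp_of K /\
       forall alpha, 0 < alpha <= a1 ->
         exists const : R, 0 < const /\
           exists h1 : R, 0 < h1 <= 1 / 5 /\
             forall h, 0 < h <= h1 ->
               Rbar_le (const * h ^ p)
                 (Lub_Rbar (fun y => exists x, Rabs x <= eps_of K /\
                              y = Rabs (x - conjJ NPhi Nphi (eps_of K) h x alpha)))).
Proof.
  intros p _. split.
  - intros f Phi phi d _ _ _ _ _ k h0 e0 a0 K c NPhi Nphi eta eta' Hk HN _.
    exists (40 * c). split.
    + assert (Hc := nfp_c _ _ _ _ _ _ _ _ _ _ _ HN). lra.
    + apply (conjugacy_estimate p k h0 e0 a0 K c NPhi Nphi eta eta'); [lia|assumption].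
  - exists 1, 1, (cubic_model 0 p), (cubic_model 1 p),
      (fun h _ _ => 0 * h ^ p), (fun h _ _ => 1 * h ^ p).
    split; [apply cubic_model_pair|].
    exists (alp_of 1). split; [rewrite alp_of_1; lra|].
    intros a Ha. exists (a ^ 2 / 2). split.
    + assert (0 < a ^ 2) by (apply pow2_gt_0; lra). lra.
    + exists (1 / 5). split; [lra|]. intros h Hh.
      destruct (cubic_model_displacement p h a Hh Ha) as (w & Hw & Hd).
      apply Rbar_le_trans with
        (Finite (Rabs (w - conjJ (cubic_model 0 p) (cubic_model 1 p) (eps_of 1) h w a)));
        [exact Hd|].
      apply Lub_Rbar_correct. exists w. split; [exact Hw|reflexivity].
Qed.
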